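(* Let $(M_i)_{i\in I}$ be a finite family of smooth manifolds carrying integrable systems with commuting vector fields $X_{i,1},\dots,X_{i,p_i}$ and first integrals $f_{i,k}$ ($k\in K_i$), and let $M\subset\prod_{i\in I}M_i$ be the associated diagonal manifold, with the notations and assumptions of the context. Then on the diagonal manifold $M$, of dimension $|K|+\sum_{i\in I}p_i$, we have an integrable system of type $\left(\sum_{i\in I}p_i,\ |K|\right)$, consisting of the $\sum_{i\in I}p_i$ commuting vector fields $\widehat X_{i,j}$ ($i\in I$, $j\le p_i$) and the $|K|$ first integrals $F_k$ ($k\in K$).
   Context: An integrable system of type $(p,q)$ on an $n$-dimensional manifold, $p+q=n$, is an $n$-tuple $(X_1,\dots,X_p,F_1,\dots,F_q)$ of vector fields $X_i$ and functions $F_\ell$ with $[X_i,X_j]=0$ for all $i,j$, ${\rm d}F_\ell(X_i)=0$ for all $i,\ell$, $X_1\wedge\dots\wedge X_p\neq0$ almost everywhere, and ${\rm d}F_1\wedge\dots\wedge{\rm d}F_q\neq0$ almost everywhere. Setting. $I$ and $K$ are disjoint finite index sets. For each $i\in I$, $M_i$ is a smooth manifold of dimension $n_i$. For each $k\in K$ there is a nonempty subset $S_k\subset I$ and, for each $i\in S_k$, a given smooth function $f_{i,k}:M_i\to\mathbb R$. Put $K_i=\{k\in K\mid i\in S_k\}$. For each $i\in I$ there is an integrable system on $M_i$ whose functionally independent first integrals are the $f_{i,k}$, $k\in K_i$, and whose linearly independent commuting vector fields are $X_{i,1},\dots,X_{i,p_i}$; so $p_i+|K_i|=n_i$. The diagonal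 manifold is $$M=\Big\{\mathbf x=(x_i)\in\prod_{i\in I}M_i\ \Big|\ f_{i,k}(x_i)=f_{j,k}(x_j)\ \ \forall i,j\in I,\ \forall k\in K_i\cap K_j\Big\}.$$ Let $\pi_i:\prod_{j\in I}M_j\to M_i$ be the projections. It is assumed that the functions $\pi_i^*f_{i,k}-\pi_j^*f_{j,k}$ ($k\in K_i\cap K_j$) have linearly independent differentials on $M$, apart from the obvious relations of the type $\pi_i^*f_{i,k}-\pi_j^*f_{j,k}=(\pi_i^*f_{i,k}-\pi_\ell^*f_{\ell,k})+(\pi_\ell^*f_{\ell,k}-\pi_j^*f_{j,k})$; therefore $M$ is a smooth manifold (each $k\in K$ contributes $|S_k|-1$ independent equations). $\widehat X_{i,j}$ denotes the horizontal lift of $X_{i,j}$ to $\prod_{i\in I}M_i$, i.e. the unique vector field whose projection by $\pi_i$ is $X_{i,j}$ and whose projections by the other $\pi_{i'}$, $i'\neq i$, are trivial; it is tangent to $M$, and its restriction to $M$ is denoted in the same way. For $k\in K$, $F_k:M\to\mathbb R$ is defined by $F_k(\mathbf x)=f_{i,k}(x_i)$ for some $i\in S_k$; it is well defined by the definition of $M$.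
   Formalization: Added assumption: at almost every point x of M, for each i, the differentials of the f_{i,k} (k in K_i) are independent at x_i. Without it the F_k may all be constant on M, so the claim fails; it is also necessary for the F_k to be independent almost everywhere on M. *)

(* Defs.v *)
From HB Require Import structures.
From mathcomp Require Import all_boot all_order all_algebra.
From mathcomp Require Import all_classical all_reals all_analysis.

Set Implicit Arguments.
Unset Strict Implicit.
Unset Printing Implicit Defensive.

Import Order.TTheory GRing.Theory Num.Theory.
Import numFieldNormedType.Exports.

Local Open Scope classical_set_scope.
Local Open Scope ring_scope.

(** * Calculus on open subsets of R^n *)

Fixpoint Ck_on (R : realType) (V W : normedModType R) (k : nat) (U : set V)
    (f : V -> W) : Prop :=
  match k with
  | 0 => {in U, continuous f}
  | k'.+1 => (forall x, U x -> differentiable f x) /\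
             forall v : V, Ck_on k' U (fun x => 'D_v f x)
  end.

(* Meant for an open set [U]: the values of [f] outside [U] are irrelevant. *)
Definition smooth_on (R : realType) (V W : normedModType R) (U : set V)
    (f : V -> W) : Prop := forall k, Ck_on k U f.

Definition cube (R : realType) (n : nat) (c : 'rV[R]_n) (r : R) :
    set 'rV[R]_n := [set x | forall j, `|x 0 j - c 0 j| <= r].

(* Lebesgue-null subsets of R^n: countable covers by cubes of arbitrarily small
   total volume.  The cubes are indexed by an arbitrary subset [D] of nat, so
   that the empty cover is available when n = 0. *)
Definition null_set (R : realType) (n : nat) (A : set 'rV[R]_n) : Prop :=
  forall e : R, 0 < e ->
  exists (D : pred nat) (c : nat -> 'rV[R]_n) (r : nat -> R),
    [/\ forall k, 0 <= r k,
        A `<=` \bigcup_(k in [set k | D k]) cube (c k) (r k) &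
        forall m, \sum_(k < m | D k) (2 * r k) ^+ n <= e].

(* v_1 /\ ... /\ v_p <> 0 for a family of vectors or covectors of R^n: the
   coordinates of the wedge product are the p x p minors of the components. *)
Definition wedge_neq0 (R : realType) (J : finType) (n : nat)
    (v : J -> 'rV[R]_n) : Prop :=
  exists s : 'I_#|J| -> 'I_n,
    \det (\matrix_(a, b) v (enum_val a) 0 (s b)) != 0.

(** * Smooth manifolds *)

(* [cmap] and [cinv] are only meaningful on [cdom] and on [cimg]. *)
Record chart (R : realType) (T : topologicalType) (n : nat) := Chart {
  cdom : set T;
  cmap : T -> 'rV[R]_n;
  cinv : 'rV[R]_n -> T }.

Definition cimg (R : realType) (T : topologicalType) (n : nat)
  (c : chart R T n) : set 'rV[R]_n := cmap c @` cdom c.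

Definition is_chart (R : realType) (T : topologicalType) (n : nat)
    (c : chart R T n) : Prop :=
  [/\ open (cdom c), open (cimg c),
      forall x, cdom c x -> cinv c (cmap c x) = x,
      {in cdom c, continuous (cmap c)} &
      {in cimg c, continuous (cinv c)}].

Record charted_space (R : realType) (n : nat) := ChartedSpace {
  carrier :> topologicalType;
  chart_idx : Type;
  at_chart : chart_idx -> chart R carrier n }.

Coercion at_chart : chart_idx >-> chart.

Record is_manifold (R : realType) (n : nat) (M : charted_space R n) : Prop := {
  manifold_hausdorff : hausdorff_space M;
  manifold_second_countable : @second_countable M;
  manifold_chart : forall a : chart_idx M, is_chart a;
  manifold_cover : forall x : M, exists a : chart_idx M, cdom a x;
  manifold_transition : forall a b : chart_idx M,
    smooth_on (cmap a @` (cdom a `&` cdom b)) (cmap b \o cinv a) }.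

Definition ae_on (R : realType) (n : nat) (M : charted_space R n)
    (P : M -> Prop) : Prop :=
  forall a : chart_idx M, null_set (cmap a @` (cdom a `&` [set x | ~ P x])).

Definition smooth_fun (R : realType) (n : nat) (M : charted_space R n)
    (F : M -> R) : Prop :=
  forall a : chart_idx M,
    smooth_on (cimg a) ((F \o cinv a : 'rV[R]_n -> R^o)).

(* The components of dF at x in the chart a. *)
Definition dF (R : realType) (n : nat) (M : charted_space R n)
    (a : chart_idx M) (F : M -> R) (x : M) : 'rV[R]_n :=
  \row_j 'D_(delta_mx 0 j : 'rV[R]_n) (F \o cinv a : 'rV[R]_n -> R^o)
    (cmap a x).

(* A vector field is given by its components in each chart of the atlas; see
   [smooth_vfield] for the transformation rule. *)
Definition vfield (R : realType) (n : nat) (M : charted_space R n) :=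
  chart_idx M -> M -> 'rV[R]_n.

Definition smooth_vfield (R : realType) (n : nat) (M : charted_space R n)
    (X : vfield M) : Prop :=
  (forall (a b : chart_idx M) (x : M), cdom a x -> cdom b x ->
     X b x = 'D_(X a x) (cmap b \o cinv a) (cmap a x)) /\
  (forall a : chart_idx M, smooth_on (cimg a) (X a \o cinv a)).

(* The function dF(X), at x, in the chart a. *)
Definition dF_vfield (R : realType) (n : nat) (M : charted_space R n)
    (a : chart_idx M) (F : M -> R) (X : vfield M) (x : M) : R :=
  'D_(X a x) (F \o cinv a : 'rV[R]_n -> R^o) (cmap a x).

(* The components of [X, Y] at x in the chart a. *)
Definition lie_bracket (R : realType) (n : nat) (M : charted_space R n)
    (X Y : vfield M) : vfield M :=
  fun a x => 'D_(X a x) (Y a \o cinv a) (cmap a x)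
             - 'D_(Y a x) (X a \o cinv a) (cmap a x).

Definition vfields_independent_at (R : realType) (n : nat)
    (M : charted_space R n) (J : finType) (X : J -> vfield M) (x : M) : Prop :=
  forall a : chart_idx M, cdom a x -> wedge_neq0 (fun j => X j a x).

Definition funs_independent_at (R : realType) (n : nat)
    (M : charted_space R n) (L : finType) (F : L -> M -> R) (x : M) : Prop :=
  forall a : chart_idx M, cdom a x -> wedge_neq0 (fun l => dF a (F l) x).

(* dh (Y) = X o h: the vector field Y projects to X along h. *)
Definition vfield_related (R : realType) (m n : nat) (M : charted_space R m)
    (N : charted_space R n) (h : M -> N) (Y : vfield M) (X : vfield N) : Prop :=
  forall (a : chart_idx M) (b : chart_idx N) (x : M),
    cdom a x -> cdom b (h x) ->
    'D_(Y a x) (cmap b \o h \o cinv a) (cmap a x) = X b (h x).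

Record integrable_system (R : realType) (n : nat) (M : charted_space R n)
    (p q : nat) (J L : finType) (X : J -> vfield M) (F : L -> M -> R) :
    Prop := {
  integrable_card_vfields : #|J| = p;
  integrable_card_funs : #|L| = q;
  integrable_dim : (p + q = n)%N;
  integrable_vfields : forall j, smooth_vfield (X j);
  integrable_funs : forall l, smooth_fun (F l);
  integrable_commute : forall (i j : J) (a : chart_idx M) (x : M),
    cdom a x -> lie_bracket (X i) (X j) a x = 0;
  integrable_first_integral : forall (j : J) (l : L) (a : chart_idx M) (x : M),
    cdom a x -> dF_vfield a (F l) (X j) x = 0;
  integrable_vfields_ae : ae_on (vfields_independent_at X);
  integrable_funs_ae : ae_on (funs_independent_at F) }.

(** * Finite products *)

(* The dimension of the product, card_tagged: it is equal to \sum_i n i. *)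
Definition pdim (I : finType) (n : I -> nat) : nat := #|{: {i : I & 'I_(n i)}}|.

Definition to_block (R : realType) (I : finType) (n : I -> nat) (i : I)
    (v : 'rV[R]_(n i)) : 'rV[R]_(pdim n) :=
  \sum_(j < n i) v 0 j *:
    delta_mx 0 (enum_rank (Tagged (fun i => 'I_(n i)) j)).

Definition block (R : realType) (I : finType) (n : I -> nat) (i : I)
    (u : 'rV[R]_(pdim n)) : 'rV[R]_(n i) :=
  \row_j u 0 (enum_rank (Tagged (fun i => 'I_(n i)) j)).

Definition prod_chart (R : realType) (I : finType) (n : I -> nat)
    (M : forall i, charted_space R (n i)) (a : forall i, chart_idx (M i)) :
    chart R (prod_topology (fun i => carrier (M i))) (pdim n) :=
  @Chart R (prod_topology (fun i => carrier (M i))) (pdim n)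
    [set x | forall i, cdom (a i) (x i)]
    (fun x => \sum_i to_block (cmap (a i) (x i)))
    (fun u i => cinv (a i) (block i u)).

Definition prod_space (R : realType) (I : finType) (n : I -> nat)
    (M : forall i, charted_space R (n i)) : charted_space R (pdim n) :=
  ChartedSpace (@prod_chart R I n M).

Definition horizontal_lift (R : realType) (I : finType) (n : I -> nat)
    (M : forall i, charted_space R (n i)) (i : I) (X : vfield (M i)) :
    vfield (prod_space M) :=
  fun a x => to_block (X (a i) (x i)).

Lemma block_to_block (R : realType) (I : finType) (n : I -> nat) (i : I)
  (v : 'rV[R]_(n i)) : block i (to_block v) = v.
Proof.
apply/rowP => j; rewrite mxE summxE (bigD1 j) //= !mxE !eqxx mulr1 big1 ?addr0 //.
move=> k kj; rewrite !mxE eqxx (inj_eq enum_rank_inj) eq_Tagged /=.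
by rewrite eq_sym (negPf kj) mulr0.
Qed.

Lemma block_to_block_neq (R : realType) (I : finType) (n : I -> nat) (i i' : I)
  (v : 'rV[R]_(n i)) : i' != i -> block i' (to_block v) = 0.
Proof.
move=> ne; apply/rowP => j; rewrite !mxE summxE big1 // => k _.
rewrite !mxE eqxx (inj_eq enum_rank_inj) -tag_eqE /tag_eq /= (negPf ne) /=.
by rewrite mulr0.
Qed.

(** * Embedded submanifolds *)

(* [c] is a homeomorphism from an open subset of [A] (for the induced topology)
   to an open subset of R^d, whose inverse is a smooth immersion into [M]. *)
Definition is_submanifold_chart (R : realType) (n d : nat)
    (M : charted_space R n) (A : set M) (c : chart R (set_type A) d) : Prop :=
  is_chart c /\
  forall b : chart_idx M,
    let U := cdom c `&` [set x | cdom b (set_val x)] in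
    let h := (cmap b \o set_val \o cinv c : 'rV[R]_d -> 'rV[R]_n) in
    smooth_on (cmap c @` U) h /\
    forall (x : set_type A) (v : 'rV[R]_d),
      U x -> 'D_v h (cmap c x) = 0 -> v = 0.

(* [A] with the induced topology and all its d-dimensional submanifold charts:
   [is_manifold (submanifold A d)] says that A is an embedded submanifold of
   dimension d, this atlas being then its (maximal) smooth structure. *)
Definition submanifold (R : realType) (n : nat) (M : charted_space R n)
    (A : set M) (d : nat) : charted_space R d :=
  @ChartedSpace R d (set_type A) {c | @is_submanifold_chart R n d M A c}
    (fun c => projT1 c).

(** * The diagonal manifold *)

Section Diagonal.
Variables (R : realType) (I K : finType) (n : I -> nat).
Variables (M : forall i, charted_space R (n i)).
Variables (S : K -> {set I}).

Definition K_of (i : I) : finType := {k : K | i \in S k}.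

(* f i k is only meaningful for i \in S k. *)
Variable f : forall i, K -> M i -> R.

Definition integrals_of (i : I) : K_of i -> M i -> R := fun k => @f i (val k).

Definition diagonal_subset : set (prod_space M) :=
  [set x | forall i j k, i \in S k -> j \in S k ->
                         f k (x i) = f k (x j)].

(* pi_i^* f_{i,k} - pi_j^* f_{j,k} *)
Definition constraint (k : K) (i j : I) : prod_space M -> R :=
  fun x => f k (x i) - f k (x j).

(* Every linear relation, with coefficients c, between the differentials at x
   of the constraints g_{ij} = pi_i^* f_{i,k} - pi_j^* f_{j,k} is a combination,
   with coefficients r k i l j, of the relations g_{ij} - g_{il} - g_{lj} = 0. *)
Definition independent_up_to_obvious (x : prod_space M) : Prop :=
  forall a : chart_idx (prod_space M), cdom a x ->
  forall c : K -> I -> I -> R,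
    \sum_k \sum_(i in S k) \sum_(j in S k)
      c k i j *: dF a (constraint k i j) x = 0 ->
    exists r : K -> I -> I -> I -> R,
      forall k i j, i \in S k -> j \in S k ->
        c k i j = \sum_(l in S k) (r k i l j - r k i j l - r k l i j).

Definition diagonal_manifold (d : nat) : charted_space R d :=
  submanifold diagonal_subset d.

(* The default value is not used when S k is nonempty. *)
Definition diagonal_integral (d : nat) (k : K) : diagonal_manifold d -> R :=
  fun x => if [pick i in S k] is Some i then f k (set_val x i) else 0.

Lemma diagonal_integralE (d : nat) (k : K) (i : I) (x : diagonal_manifold d) :
  i \in S k -> diagonal_integral k x = f k (set_val x i).
Proof.
move=> iS; rewrite /diagonal_integral; case: pickP => [j jS|/(_ i)]; last first.
  by rewrite iS.
by have /(_ j i k jS iS) := set_mem (valP x).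
Qed.

(* Almost every point of the diagonal has components at which the given first
   integrals of each factor are independent.  This does not follow from
   independence almost everywhere on each factor: with
     M_1 = {(s, t) : |t| < 1/2}, f_{1,1} = s,      f_{1,2} = s * t,
     M_2 = {(u, v) : |u| < 1/2}, f_{2,1} = u * v,  f_{2,2} = v,
   (types (0, 2)) the constraints s = u * v and s * t = v are independent on
   the diagonal, which is the surface s = v = 0, on which both
   F_1 = s and F_2 = v vanish identically. *)
Definition integrals_independent_along_diagonal (d : nat) : Prop :=
  ae_on (fun x : diagonal_manifold d =>
    forall i, funs_independent_at (integrals_of (i := i)) (set_val x i)).

End Diagonal.

Arguments integrals_of [R I K n M] S f i.
Arguments diagonal_integral [R I K n M] S f d.

(* Main.v *)
(** On the diagonal, each [k] contributes the |S_k| - 1 equations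
    f_{ref k,k} = f_{i,k} with i <> ref k, for a chosen ref k in S_k.  Modulo the
    obvious relations these have independent differentials, so the implicit
    function theorem provides charts, and by a dimension count the tangent space
    of M is exactly the set of v = (v_i) such that df_{i,k}(v_i) does not depend
    on i in S_k.

    The horizontal lifts lie in this space, so they restrict to M.  They are
    smooth because the inclusion of M has local smooth left inverses, and they
    commute because, on each factor, they are related to commuting fields.
    At a point of M whose components are all regular, arbitrary values of the
    dF_k are attained by choosing v_i with df_{i,k}(v_i) prescribed, and in the
    same way each projection M -> M_i is a submersion.  Preimages of null sets
    by submersions are null, so the X_{i,j} remain independent almost everywhere
    on M. *)

Require Import Defs.
From HB Require Import structures.
From mathcomp Require Import all_boot all_order all_algebra.
From mathcomp Require Import all_classical all_reals all_analysis.
From mathcomp Require Import ring lra.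

Set Implicit Arguments.
Unset Strict Implicit.
Unset Printing Implicit Defensive.

Import Order.TTheory GRing.Theory Num.Theory.
Import numFieldNormedType.Exports.

Local Open Scope classical_set_scope.
Local Open Scope ring_scope.

(** * Differential calculus on open sets *)

(** The hypothesis on the constraints involves all pairs (i, j) modulo obvious relations. It is
    exploited by pairing a relation with the differences phi i - phi j: this annihilates the obvious
    relations for every phi, and the indicator function of one index isolates a single coefficient.
    The local analysis rests on two estimates near a point x0: f x - f y is close to the
    differential at x0 applied to x - y, and, if this differential is injective, |f x - f y| >= c |x
    - y|. The second one serves twice: in the inverse function theorem, and to bound the size of the
    pieces when a null set is pulled back. A vector field has to be given in every chart of the
    maximal atlas of M. The lift is therefore specified pointwise, as the unique vector with a
    prescribed image under the injective differential of the inclusion, and identities between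
    lifted fields are verified on these images. *)

Section differentials.
Variables (R : realType) (V W : normedModType R).
Implicit Types (f g : V -> W).

(** The explicit epsilon form of differentiability, in which the differential of an inverse map can
    be obtained from norm estimates. *)
Lemma differentiable_of_bound f (df : {linear V -> W}) (x : V) :
  continuous df ->
  (forall e : R, 0 < e ->
     \forall h \near (0 : V), `|f (h + x) - f x - df h| <= e * `|h|) ->
  differentiable f x /\ 'd f x = df :> (V -> W).
Proof.
move=> dfc H.
have E : f \o shift x = cst (f x) + df +o_ 0 id.
  apply/eqaddoP => e e0; near=> h => /=.
  rewrite /cst [X in `|X|](_ : _ = f (h + x) - f x - df h); last first.
    by rewrite -[LHS]/(f (h + x) - (f x + df h)) opprD addrA.
  by near: h; exact: H.
have D := diff_unique dfc E; split=> //.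
by apply/diff_locallyP; rewrite D.
Unshelve. all: by end_near. Qed.

Lemma differentiable_bound f (x : V) (e : R) :
  differentiable f x -> 0 < e ->
  \forall h \near (0 : V), `|f (h + x) - f x - 'd f x h| <= e * `|h|.
Proof.
move=> /diff_locallyP [_ /eqaddoP/(_ e) +] e0 => /(_ e0); apply: filterS => h /=.
suff -> : (f \o shift x - (cst (f x) + 'd f x)) h = f (h + x) - f x - 'd f x h by [].
by rewrite -[LHS]/(f (h + x) - (f x + 'd f x h)) opprD addrA.
Qed.

Lemma near_eq_differentiable f g (x : V) :
  (\near x, f x = g x) -> differentiable f x -> differentiable g x.
Proof.
move=> fg df.
have [//|] := @differentiable_of_bound g ('d f x) x (diff_continuous df).
move=> e e0; have H := differentiable_bound df e0.
have fg0 : \forall h \near (0:V), f (h + x) = g (h + x).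
  move: fg; rewrite (near_shift 0); apply: filterS => h /=.
  by rewrite subr0.
have fgx : f x = g x by exact: nbhs_singleton fg.
near=> h.
rewrite -fgx -(near fg0 h)//.
by near: h; exact: H.
Unshelve. all: by end_near. Qed.
End differentials.

(** * Closure properties of C^k maps *)

Section Ck.
Variables (R : realType) (V : normedModType R).
Implicit Types (U : set V).

Lemma near_open_set U (x : V) (P : V -> Prop) :
  open U -> U x -> (forall y, U y -> P y) -> \forall y \near x, P y.
Proof.
by move=> oU Ux H; apply: filterS H _; exact: open_nbhs_nbhs (conj oU Ux).
Qed.

Lemma Ck_on_subset (W : normedModType R) k U U' (f : V -> W) :
  U `<=` U' -> Ck_on k U' f -> Ck_on k U f.
Proof.
move=> UU'; elim: k f => [|k IH] f /=.
  by move=> H x /[!inE] Ux; apply: H; rewrite inE; exact: UU'.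
by move=> [H1 H2]; split=> [x /UU' /H1//|v]; exact: IH.
Qed.

(** Openness turns equality on U into equality near each point of U, which is what derivatives
    depend on. *)
Lemma Ck_on_eq (W : normedModType R) k U (f g : V -> W) :
  open U -> (forall x, U x -> f x = g x) -> Ck_on k U f -> Ck_on k U g.
Proof.
move=> oU; elim: k f g => [|k IH] f g fg /=.
  move=> H x /[!inE] Ux; rewrite /continuous_at -(fg _ Ux).
  have c : {for x, continuous f} by apply: H; rewrite inE.
  apply: cvg_trans c; apply: near_eq_cvg.
  by apply: (near_open_set oU Ux) => y /fg.
move=> [H1 H2]; split=> [x Ux|v].
  by apply: near_eq_differentiable (H1 x Ux); exact: near_open_set fg.
apply: IH (H2 v) => x Ux; apply: near_eq_derive; exact: near_open_set fg.
Qed.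

(** Each clause of [Ck_on] is a condition at a single point on the ambient map f, so U' may be any
    set containing the point, open or not. *)
Lemma Ck_on_local (W : normedModType R) k U (f : V -> W) :
  (forall x, U x -> exists2 U' : set V, U' x & Ck_on k U' f) -> Ck_on k U f.
Proof.
elim: k f => [|k IH] f /= H.
  move=> x /[!inE] Ux; have [U' U'x] := H x Ux; apply; by rewrite inE.
split=> [x Ux|v]; first by have [U' U'x [+ _]] := H x Ux; apply.
by apply: IH => x Ux; have [U' U'x [_ +]] := H x Ux => /(_ v); exists U'.
Qed.

Lemma Ck_onS (W : normedModType R) k U (f : V -> W) :
  Ck_on k.+1 U f -> Ck_on k U f.
Proof.
elim: k f => [|k IH] f.
  by move=> [H _] x /[!inE] Ux; exact/differentiable_continuous/H.
by move=> [H1 H2]; split=> // v; exact: IH.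
Qed.

Lemma Ck_on_cst (W : normedModType R) k U (c : W) : Ck_on k U (cst c : V -> W).
Proof.
elim: k c => [|k IH] c /=; first by move=> x _; exact: cst_continuous.
split=> [x _|v]; first exact: differentiable_cst.
rewrite (_ : (fun x => _) = cst 0); first exact: IH.
by apply/funext => x; rewrite derive_cst.
Qed.

Lemma Ck_on_comp_linear (W W' : normedModType R) k U (f : V -> W)
    (L : {linear W -> W'}) :
  open U -> continuous L -> Ck_on k U f -> Ck_on k U (L \o f).
Proof.
move=> oU cL; elim: k f => [|k IH] f /=.
  move=> H x Ux; apply: continuous_comp; [exact: H|exact: cL].
have dL y : differentiable L y by exact: linear_differentiable.
move=> [H1 H2]; split=> [x Ux|v].
  by apply: differentiable_comp; [exact: H1|].
apply: (Ck_on_eq oU) (IH _ (H2 v)) => x Ux /=.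
have df := H1 x Ux.
rewrite [in RHS]deriveE; last exact: differentiable_comp.
by rewrite diff_comp //= diff_lin // deriveE.
Qed.

Lemma Ck_on_comp_lin (W W' : normedModType R) k U (f : V -> W) (L : W -> W') :
  open U -> linear L -> continuous L -> Ck_on k U f -> Ck_on k U (fun x => L (f x)).
Proof.
move=> oU lL cL; pose LM := GRing.isLinear.Build _ _ _ _ _ lL.
pose L' : {linear _ -> _} := HB.pack L LM.
exact: (@Ck_on_comp_linear _ _ k U f L').
Qed.

Lemma Ck_on_id k U : Ck_on k U (id : V -> V).
Proof.
case: k => [|k] /=; first by move=> x _; exact: cvg_id.
split=> [x _|v]; first exact: ex_diff.
rewrite (_ : (fun x => _) = cst v); first exact: Ck_on_cst.
by apply/funext => x; rewrite derive_id.
Qed.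

Lemma Ck_onD (W : normedModType R) k U (f g : V -> W) :
  open U -> Ck_on k U f -> Ck_on k U g -> Ck_on k U (f \+ g).
Proof.
move=> oU; elim: k f g => [|k IH] f g /=.
  by move=> H1 H2 x Ux; apply: continuousD; [exact: H1|exact: H2].
move=> [H1 H2] [H3 H4]; split=> [x Ux|v].
  by apply: differentiableD; [exact: H1|exact: H3].
apply: (Ck_on_eq oU) (IH _ _ (H2 v) (H4 v)) => x Ux /=.
by rewrite deriveD //; apply: diff_derivable; [exact: H1|exact: H3].
Qed.

Lemma Ck_on_sum (W : normedModType R) k U (I : Type) (r : seq I) (P : pred I)
    (f : I -> V -> W) :
  open U -> (forall i, Ck_on k U (f i)) ->
  Ck_on k U (fun x => \sum_(i <- r | P i) f i x).
Proof.
move=> oU H; elim: r => [|i r IH].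
  rewrite (_ : (fun _ => _) = cst 0); first exact: Ck_on_cst.
  by apply/funext => x; rewrite big_nil.
case Pi: (P i); last first.
  rewrite (_ : (fun _ => _) = (fun x => \sum_(i <- r | P i) f i x)) //.
  by apply/funext => x; rewrite big_cons Pi.
rewrite (_ : (fun _ => _) = f i \+ (fun x => \sum_(i <- r | P i) f i x)).
  exact: Ck_onD.
by apply/funext => x /=; rewrite big_cons Pi.
Qed.

Lemma Ck_onM k U (f g : V -> R^o) :
  open U -> Ck_on k U f -> Ck_on k U g -> Ck_on k U ((f : V -> R) \* g : V -> R^o).
Proof.
move=> oU; elim: k f g => [|k IH] f g H1 H2.
  by move=> x Ux; apply: continuousM; [exact: H1|exact: H2].
(* The product rule keeps one factor undifferentiated, so class C^k of f and g is needed beside that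
   of their derivatives. *)
have [/= {}H1 H1'] := (H1, Ck_onS H1); have [/= {}H2 H2'] := (H2, Ck_onS H2).
split=> [x Ux|v].
  by apply: differentiableM; [exact: H1.1|exact: H2.1].
have := Ck_onD oU (IH _ _ H1' (H2.2 v)) (IH _ _ H2' (H1.2 v)).
apply: (Ck_on_eq oU) => x Ux /=.
by rewrite [in RHS]deriveM //; apply: diff_derivable; [exact: H1.1|exact: H2.1].
Qed.

Lemma Ck_onN (W : normedModType R) k U (f : V -> W) :
  open U -> Ck_on k U f -> Ck_on k U (fun x => - f x).
Proof.
move=> oU; elim: k f => [|k IH] f /=.
  by move=> H x Ux; apply: continuousN; exact: H.
move=> [H1 H2]; split=> [x Ux|v].
  by apply: differentiableN; exact: H1.
apply: (Ck_on_eq oU) (IH _ (H2 v)) => x Ux /=.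
by rewrite deriveN //; apply: diff_derivable; exact: H1.
Qed.

Lemma Ck_onV k U (f : V -> R^o) :
  open U -> (forall x, U x -> f x != 0) ->
  Ck_on k U f -> Ck_on k U (fun x => (f x)^-1 : R^o).
Proof.
move=> oU f0; elim: k => [|k IH] H.
  by move=> x Ux; apply: continuousV; [apply: f0; rewrite inE in Ux|exact: H].
have V1 := IH (Ck_onS H); move: H => /= [H1 H2].
split=> [x Ux|v]; first by apply: differentiableV; [exact: H1|exact: f0].
have := Ck_onN oU (Ck_onM oU (Ck_onM oU V1 V1) (H2 v)).
apply: (Ck_on_eq oU) => x Ux /=.
rewrite [in RHS]deriveV ?f0//; last by apply: diff_derivable; exact: H1.
by rewrite -[RHS]/(- f x ^- 2 * 'D_v f x) expr2 invfM mulNr.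
Qed.

Lemma Ck_on_prod k U (I : Type) (r : seq I) (P : pred I) (f : I -> V -> R^o) :
  open U -> (forall i, Ck_on k U (f i)) ->
  Ck_on k U (fun x => \prod_(i <- r | P i) (f i x : R) : R^o).
Proof.
move=> oU H; elim: r => [|i r IH].
  rewrite (_ : (fun _ => _) = cst 1); first exact: Ck_on_cst.
  by apply/funext => x; rewrite big_nil.
case Pi: (P i); last first.
  rewrite (_ : (fun _ => _) = (fun x => \prod_(i <- r | P i) f i x)) //.
  by apply/funext => x; rewrite big_cons Pi.
rewrite (_ : (fun _ => _) =
    (f i : V -> R) \* (fun x => \prod_(i <- r | P i) (f i x : R))).
  exact: Ck_onM.
by apply/funext => x /=; rewrite big_cons Pi.
Qed.

Lemma rV_linear_continuous (W : normedModType R) n (L : {linear 'rV[R]_n -> W}) :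
  continuous L.
Proof.
rewrite (_ : L = (fun x => \sum_(j < n) x 0 j *: L (delta_mx 0 j)) :> (_ -> _)).
  apply: (@continuous_big _ _ +%R) => [|j _ x]; first exact: add_continuous.
  apply: (@continuous_comp _ _ _ (fun y : 'rV[R]_n => y 0 j)
    ( *:%R^~ (L (delta_mx 0 j)))); first exact: coord_continuous.
  exact: scalel_continuous.
apply/funext => x; rewrite [in LHS](row_sum_delta x) linear_sum.
by apply: eq_bigr => j _; rewrite linearZ.
Qed.

Lemma Ck_on_coord k U n (f : V -> 'rV[R]_n) j :
  open U -> Ck_on k U f -> Ck_on k U (fun x => f x 0 j : R^o).
Proof.
move=> oU H.
apply: (@Ck_on_comp_lin _ R^o k U f (fun y => y 0 j)) => //.
  by move=> a u v; rewrite !mxE.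
exact: coord_continuous.
Qed.

Lemma Ck_on_rV k U n (f : V -> 'rV[R]_n) :
  open U -> (forall j, Ck_on k U (fun x => f x 0 j : R^o)) -> Ck_on k U f.
Proof.
move=> oU H.
rewrite (_ : f = (fun x => \sum_(j < n) f x 0 j *: delta_mx 0 j)); last first.
  by apply/funext => x; rewrite -row_sum_delta.
apply: Ck_on_sum => // j.
apply: (@Ck_on_comp_lin R^o _ k U (fun x => f x 0 j)
  ( *:%R^~ (delta_mx 0 j : 'rV[R]_n))) => //.
  by move=> a u v; rewrite scalerDl scalerA.
exact: scalel_continuous.
Qed.

Lemma derive_rV (W : normedModType R) n (f : 'rV[R]_n -> W) (x v : 'rV[R]_n) :
  differentiable f x -> 'D_v f x = \sum_j v 0 j *: 'D_(delta_mx 0 j) f x.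
Proof.
move=> df; rewrite deriveE // [in LHS](row_sum_delta v) linear_sum.
by apply: eq_bigr => j _; rewrite linearZ /= deriveE.
Qed.

Lemma derive_comp (V' W : normedModType R) (f : V -> V') (g : V' -> W) (x v : V) :
  differentiable f x -> differentiable g (f x) ->
  'D_v (g \o f) x = 'D_('D_v f x) g (f x).
Proof.
move=> df dg; rewrite !deriveE //; last exact: differentiable_comp.
by rewrite diff_comp.
Qed.

Lemma Ck_on_comp_R k U n (U' : set 'rV[R]_n) (f : V -> 'rV[R]_n)
    (g : 'rV[R]_n -> R^o) :
  open U -> (forall x, U x -> U' (f x)) ->
  Ck_on k U f -> Ck_on k U' g -> Ck_on k U (g \o f).
Proof.
move=> oU fU; elim: k g => [|k IH] g H1 H2.
  move=> x Ux; apply: continuous_comp; first exact: H1.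
  by apply: H2; rewrite inE; apply: fU; rewrite inE in Ux.
have H1' := Ck_onS H1; move: H1 H2 => /= [H1 H1d] [H2 H2d].
split=> [x Ux|v].
  by apply: differentiable_comp; [exact: H1|exact/H2/fU].
(* The chain rule differentiates g along ['D_v f x], which varies with x, while [Ck_on] only knows
   fixed directions. Expanding along the basis leaves products of a coordinate and a composition
   covered by the induction hypothesis. *)
have : Ck_on k U (fun x => \sum_j (('D_v f x 0 j : R^o) *
    (('D_(delta_mx 0 j) g) \o f) x) : R^o).
  apply: Ck_on_sum => // j; apply: Ck_onM => //.
    by apply: Ck_on_coord.
  exact: IH.
apply: (Ck_on_eq oU) => x Ux.
rewrite [RHS](derive_comp _ (H1 x Ux) (H2 _ (fU _ Ux))).
by rewrite derive_rV //; exact/H2/fU.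
Qed.

End Ck.

Lemma Ck_on_comp (R : realType) (V : normedModType R) k (U : set V) n m
    (U' : set 'rV[R]_n) (f : V -> 'rV[R]_n) (g : 'rV[R]_n -> 'rV[R]_m) :
  open U -> open U' -> (forall x, U x -> U' (f x)) ->
  Ck_on k U f -> Ck_on k U' g -> Ck_on k U (g \o f).
Proof.
move=> oU oU' fU H1 H2; apply: Ck_on_rV => // j.
apply: (Ck_on_comp_R (U' := U') oU fU H1 (g := fun y => g y 0 j)).
exact: Ck_on_coord oU' H2.
Qed.

Section smooth.
Variables (R : realType) (V : normedModType R).
Implicit Types (U : set V).

Lemma smooth_on_derive (W : normedModType R) U (f : V -> W) v :
  smooth_on U f -> smooth_on U ('D_v f).
Proof. by move=> H k; have [_] := H k.+1; apply. Qed.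

Lemma smooth_on_diff (W : normedModType R) U (f : V -> W) x :
  smooth_on U f -> U x -> differentiable f x.
Proof. by move=> H Ux; have [+ _] := H 1%N; apply. Qed.

Lemma smooth_on_continuous (W : normedModType R) U (f : V -> W) x :
  smooth_on U f -> U x -> {for x, continuous f}.
Proof. by move=> H Ux; apply: (H 0%N); rewrite inE. Qed.

Lemma smooth_on_subset (W : normedModType R) U U' (f : V -> W) :
  U `<=` U' -> smooth_on U' f -> smooth_on U f.
Proof. by move=> UU H k; exact: Ck_on_subset UU (H k). Qed.

Lemma smooth_on_eq (W : normedModType R) U (f g : V -> W) :
  open U -> (forall x, U x -> f x = g x) -> smooth_on U f -> smooth_on U g.
Proof. by move=> oU fg H k; exact: Ck_on_eq oU fg (H k). Qed.

Lemma smooth_on_local (W : normedModType R) U (f : V -> W) :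
  (forall x, U x -> exists2 U' : set V, U' x & smooth_on U' f) -> smooth_on U f.
Proof.
move=> H k; apply: Ck_on_local => x /H[U' U'x sf]; exists U' => //; exact: sf.
Qed.

Lemma smooth_on_mulmx U n m (f : V -> 'rV[R]_n) (B : 'M[R]_(n, m)) :
  open U -> smooth_on U f -> smooth_on U (fun x => f x *m B).
Proof.
move=> oU H k; apply: (@Ck_on_comp_linear _ _ _ _ k U f (mulmxr B)) => //.
exact: rV_linear_continuous.
Qed.

Lemma smooth_on_coord U n (f : V -> 'rV[R]_n) j :
  open U -> smooth_on U f -> smooth_on U (fun x => f x 0 j : R^o).
Proof. by move=> oU H k; exact: Ck_on_coord. Qed.

Lemma smooth_on_rV U n (f : V -> 'rV[R]_n) :
  open U -> (forall j, smooth_on U (fun x => f x 0 j : R^o)) -> smooth_on U f.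
Proof. by move=> oU H k; apply: Ck_on_rV => // j; exact: H. Qed.

Lemma smooth_on_comp U n m (U' : set 'rV[R]_n) (f : V -> 'rV[R]_n)
    (g : 'rV[R]_n -> 'rV[R]_m) :
  open U -> open U' -> (forall x, U x -> U' (f x)) ->
  smooth_on U f -> smooth_on U' g -> smooth_on U (g \o f).
Proof. by move=> oU oU' fU Hf Hg k; exact: Ck_on_comp oU oU' fU (Hf k) (Hg k). Qed.

Lemma smooth_on_comp_R U n (U' : set 'rV[R]_n) (f : V -> 'rV[R]_n)
    (g : 'rV[R]_n -> R^o) :
  open U -> (forall x, U x -> U' (f x)) ->
  smooth_on U f -> smooth_on U' g -> smooth_on U (g \o f).
Proof. by move=> oU fU Hf Hg k; exact: Ck_on_comp_R oU fU (Hf k) (Hg k). Qed.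

End smooth.

Lemma smooth_on_derive_along (R : realType) (V : normedModType R) (U : set V)
    n m (U' : set 'rV[R]_n) (f w : V -> 'rV[R]_n) (g : 'rV[R]_n -> 'rV[R]_m) :
  open U -> open U' -> (forall x, U x -> U' (f x)) ->
  smooth_on U f -> smooth_on U w -> smooth_on U' g ->
  smooth_on U (fun x => 'D_(w x) g (f x)).
Proof.
move=> oU oU' fU sf sw sg; apply: smooth_on_rV => // i k.
have : Ck_on k U (fun x => \sum_j ((w x 0 j : R^o) *
    (('D_(delta_mx 0 j) g) \o f) x 0 i) : R^o).
  apply: Ck_on_sum => // j; apply: Ck_onM => //; first exact: smooth_on_coord.
  apply: Ck_on_coord => //.
  exact: Ck_on_comp oU oU' fU (sf k) (smooth_on_derive _ sg k).
apply: (Ck_on_eq oU) => x Ux.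
rewrite [in RHS]derive_rV; last exact: smooth_on_diff sg (fU _ Ux).
by rewrite summxE; apply: eq_bigr => j _; rewrite mxE.
Qed.

(** * Local inversion *)

Section strict.
Variable R : realType.

(** Reduces to the one-variable mean value theorem for g: the difference quotients of g at t are
    those of f along x - y. *)
Lemma line_mvt (V : normedModType R) (f : V -> R^o) (x y : V) :
  (forall t : R, 0 <= t <= 1 -> differentiable f (y + t *: (x - y))) ->
  exists2 t : R, 0 <= t <= 1 & f x - f y = 'D_(x - y) f (y + t *: (x - y)).
Proof.
move=> H.
pose g (t : R) : R := f (y + t *: (x - y)).
have E t : (fun h : R => h^-1 *: ((g \o shift t) (h *: (1 : R)) - g t)) =
  (fun h : R => h^-1 *: ((f \o shift (y + t *: (x - y))) (h *: (x - y)) -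
     f (y + t *: (x - y)))).
  apply/funext => h /=; rewrite /g /= -[h *: 1]/(h * 1) mulr1 scalerDl.
  by rewrite addrCA.
have dg (t : R) : 0 <= t <= 1 ->
    is_derive t (1 : R) (g : R -> R) ('D_(x - y) f (y + t *: (x - y))).
  move=> t01; have := diff_derivable (v := x - y) (H t t01).
  rewrite /derivable -E => dgt; split; first exact: dgt.
  by rewrite /derive E.
have [//|t /[!in_itv]/= /andP[t0 t1]||c c01] :=
    @MVT_segment R g (fun t => 'D_(x - y) f (y + t *: (x - y))) 0 1.
- by apply: dg; rewrite !ltW.
- apply: derivable_within_continuous => t; rewrite in_itv => t01.
  by apply: ex_derive; exact: dg.
rewrite /g scale1r scale0r addr0 subr0 mulr1 [y + _]addrC subrK => ->.
by exists c => //; move: c01; rewrite in_itv.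
Qed.

Lemma rV_norm_le n (v : 'rV[R]_n) (e : R) :
  0 <= e -> (forall j, `|v 0 j| <= e) -> `|v| <= e.
Proof.
move=> e0 H; rewrite [leLHS]/Num.Def.normr/= mx_normrE bigmax_le // => -[i j] _.
by rewrite ord1.
Qed.

Lemma rV_coord_le n (v : 'rV[R]_n) j : `|v 0 j| <= `|v|.
Proof.
rewrite [leRHS]/Num.Def.normr/= mx_normrE.
exact: (le_bigmax _ (fun ij : 'I_1 * 'I_n => `|v ij.1 ij.2|) (0, j)).
Qed.

Lemma mulmx_bound n m (B : 'M[R]_(n, m)) :
  exists2 C : R, 0 < C & forall v : 'rV[R]_n, `|v *m B| <= C * `|v|.
Proof.
have [C C0 H] := @linear_lipschitz R _ _ (mulmxr B) (@rV_linear_continuous R 'rV[R]_m n _).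
by exists C => // v; exact: H.
Qed.

(** By the mean value theorem the error is a difference of derivatives of f at two points near x0,
    small since the partial derivatives are continuous. The radius d is quantified by a filter so
    that finitely many coordinates can be treated together. *)
Lemma strict_derivative_R n (U : set 'rV[R]_n) (f : 'rV[R]_n -> R^o)
    (x0 : 'rV[R]_n) (e : R) :
  open U -> U x0 -> Ck_on 1 U f -> 0 < e ->
  \forall d \near (0 : R)^'+, forall x y, `|x - x0| < d -> `|y - x0| < d ->
    `|f x - f y - 'D_(x - y) f x0| <= e * `|x - y|.
Proof.
move=> oU Ux0 [df cf] e0.
(* The error is a sum of n terms, each at most [e' * |x - y|]; the added 1 covers n = 0. *)
pose e' := e / (n%:R + 1).
have n1 : 0 < n%:R + 1 :> R by rewrite ltr_wpDl.
have e'0 : 0 < e' by rewrite divr_gt0.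
have : \forall z \near x0, U z /\ forall j : 'I_n,
    `|'D_(delta_mx 0 j) f x0 - 'D_(delta_mx 0 j) f z| <= e'.
  apply: filterS2 (open_nbhs_nbhs (conj oU Ux0)) _; first by move=> z; exact: conj.
  have h (j : 'I_n) : \forall z \near x0,
      `|'D_(delta_mx 0 j) f x0 - 'D_(delta_mx 0 j) f z| <= e'.
    by have /cvgrPdist_le /(_ e' e'0) := cf (delta_mx 0 j) x0 (mem_set Ux0).
  exact: (filter_forall (nbhs_filter x0) h).
move=> /nbhs_normP[d0 /= d00 Hd]; near=> d => x y xd yd.
have seg (t : R) : 0 <= t <= 1 -> `|y + t *: (x - y) - x0| < d0.
  move=> /andP[t0 t1].
  have -> : y + t *: (x - y) - x0 = t *: (x - x0) + (1 - t) *: (y - x0).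
    by apply/rowP => j; rewrite !mxE; ring.
  apply: le_lt_trans (ler_normD _ _) _; rewrite !normrZ (ger0_norm t0).
  rewrite ger0_norm ?subr_ge0//.
  apply: (@le_lt_trans _ _ (t * Num.max `|x - x0| `|y - x0| +
     (1 - t) * Num.max `|x - x0| `|y - x0|)).
    by apply: lerD; apply: ler_wpM2l; rewrite ?subr_ge0// le_max lexx ?orbT.
  rewrite -mulrDl addrC subrK mul1r gt_max.
  by rewrite (lt_trans xd) ?(lt_trans yd)//; near: d; exact: nbhs_right_lt.
have inU t : 0 <= t <= 1 -> U (y + t *: (x - y)).
  by move=> /seg H; apply: (Hd _ _).1; rewrite /= distrC.
have [t t01 ->] := @line_mvt _ f x y (fun t ht => df _ (inU t ht)).
have [|_ Hz] := Hd (y + t *: (x - y)); first by rewrite /= distrC; exact: seg.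
rewrite !derive_rV; [|exact: df|exact/df/inU].
rewrite -sumrB; apply: le_trans (ler_norm_sum _ _ _) _.
apply: (@le_trans _ _ (\sum_(j < n) `|x - y| * e')).
  apply: ler_sum => j _; rewrite -scalerBr normrZ.
  by rewrite ler_pM // ?rV_coord_le // distrC.
rewrite sumr_const card_ord -mulr_natl mulrCA [leRHS]mulrC.
rewrite ler_wpM2l // /e' mulrCA ler_piMr ?ltW// ltr_pdivrMr //.
by rewrite mul1r ltrDl.
Unshelve. all: by end_near. Qed.

Lemma strict_derivative n m (U : set 'rV[R]_n) (f : 'rV[R]_n -> 'rV[R]_m)
    (x0 : 'rV[R]_n) (e : R) :
  open U -> U x0 -> Ck_on 1 U f -> 0 < e ->
  exists2 d : R, 0 < d & (forall x, `|x - x0| < d -> U x) /\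
    forall x y, `|x - x0| < d -> `|y - x0| < d ->
      `|f x - f y - 'D_(x - y) f x0| <= e * `|x - y|.
Proof.
move=> oU Ux0 cf e0.
have : \forall d \near (0 : R)^'+, forall j : 'I_m, forall x y,
    `|x - x0| < d -> `|y - x0| < d ->
    `|f x 0 j - f y 0 j - 'D_(x - y) (fun z => f z 0 j : R^o) x0|
       <= e * `|x - y|.
  apply: filter_forall => j; apply: (strict_derivative_R oU Ux0 _ e0).
  exact: Ck_on_coord.
move=> H; have /nbhs_normP[d0 /= d00 Hd0] := open_nbhs_nbhs (conj oU Ux0).
have d0g : \forall d \near (0 : R)^'+, 0 < d < d0.
  by near=> d; apply/andP; split; near: d; [exact: nbhs_right_gt|exact: nbhs_right_lt].
have [d [/andP[dp dd0] Hd]] := filter_ex (filterI d0g H).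
exists d => //; split=> [x xd|x y xd yd].
  by apply: Hd0; rewrite /= distrC (lt_trans xd).
apply: rV_norm_le => [|j]; first by rewrite mulr_ge0 // ltW.
rewrite !mxE (_ : ('D_(x - y) f x0) 0 j = 'D_(x - y) (fun z => f z 0 j : R^o) x0).
  exact: Hd.
by rewrite derive_mx ?mxE //; apply: diff_derivable; exact: cf.1.
Unshelve. all: by end_near. Qed.

Lemma locally_bounded_below n m (U : set 'rV[R]_n) (f : 'rV[R]_n -> 'rV[R]_m)
    (x0 : 'rV[R]_n) :
  open U -> U x0 -> Ck_on 1 U f ->
  (forall v, 'D_v f x0 = 0 -> v = 0) ->
  exists2 c : R, 0 < c & exists2 d : R, 0 < d &
    forall x y, `|x - x0| < d -> `|y - x0| < d -> c * `|x - y| <= `|f x - f y|.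
Proof.
move=> oU Ux0 cf inj; have df : differentiable f x0 by exact: cf.1.
have /row_freeP[B JB] : row_free (jacobian f x0).
  by apply: inj_row_free => v; rewrite -deriveEjacobian //; exact: inj.
have [C C0 HC] := mulmx_bound B.
(* As B inverts the Jacobian on the right, the differential of x - y has norm at least |x - y| / C;
   an error with constant 1 / (2C) consumes half of it. *)
have e0 : 0 < (2 * C)^-1 by rewrite invr_gt0 mulr_gt0.
have [d d0 [_ Hd]] := strict_derivative oU Ux0 cf e0.
exists (2 * C)^-1 => //; exists d => // x y xd yd.
have := Hd x y xd yd.
have : C^-1 * `|x - y| <= `|'D_(x - y) f x0|.
  rewrite ler_pdivrMl // deriveEjacobian //.
  by rewrite (le_trans _ (HC _)) // -mulmxA JB mulmx1.
move: (f x - f y) => u; set w := 'D_(x - y) f x0 => H1 H2.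
have H3 : `|w| <= `|u| + `|u - w|.
  by rewrite -{1}(subrK u w) addrC (le_trans (ler_normD _ _))// distrC.
have E : C^-1 = (2 * C)^-1 + (2 * C)^-1.
  by field; rewrite gt_eqF.
move: H1; rewrite E mulrDl => H1.
by rewrite -(lerD2r ((2 * C)^-1 * `|x - y|)) (le_trans H1) // (le_trans H3) // lerD2l.
Qed.

End strict.

(** * The inverse function theorem *)

Section inverse_function.
Variable R : realType.

(* [x] is found as the fixed point of the contraction x |-> x - (f x - y) B. *)
Lemma perturbed_linear_onto n (J B : 'M[R]_n) (f : 'rV[R]_n -> 'rV[R]_n)
    (x1 y : 'rV[R]_n) (C r : R) :
  0 < C -> 0 < r -> J *m B = 1%:M -> (forall v : 'rV[R]_n, `|v *m B| <= C * `|v|) ->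
  (forall x x', `|x - x1| <= r -> `|x' - x1| <= r ->
     `|f x - f x' - (x - x') *m J| <= (2 * C)^-1 * `|x - x'|) ->
  `|y - f x1| <= r / (2 * C) ->
  exists2 x, `|x - x1| <= r & f x = y.
Proof.
move=> C0 r0 JB HB Hf Hy.
have BJ : B *m J = 1%:M by exact: mulmx1C.
pose D : set 'rV[R]_n := closed_ball x1 r.
have DE x : D x <-> `|x - x1| <= r.
  by rewrite /D closed_ballE // /closed_ball_ /= distrC.
pose T (x : 'rV[R]_n) := x - (f x - y) *m B.
(* The linear parts cancel because J B = 1; what remains is the error term times B, of norm at most
   C / (2C) |x - x'|. *)
have TT x x' : D x -> D x' -> `|T x - T x'| <= 2^-1 * `|x - x'|.
  move=> /DE Dx /DE Dx'.
  have -> : T x - T x' = - ((f x - f x' - (x - x') *m J) *m B).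
    by rewrite mulmxBl -mulmxA JB mulmx1 /T !mulmxBl; apply/rowP => j; rewrite !mxE; ring.
  rewrite normrN (le_trans (HB _)) //.
  have := Hf x x' Dx Dx'; rewrite invfM [_^-1 * _^-1]mulrC -mulrA ler_pdivlMl //.
(* The centre moves by at most r / 2 and the contraction adds at most r / 2, so T preserves the
   closed ball. *)
have T1 : `|T x1 - x1| <= r / 2.
  rewrite /T addrAC subrr add0r normrN (le_trans (HB _)) // distrC.
  rewrite -ler_pdivlMl //; apply: le_trans Hy _.
  by rewrite invfM mulrA mulrC.
have x1D : D x1 by apply/DE; rewrite subrr normr0 ltW.
have TD : {homo T : x / D x >-> D x}.
  move=> x Dx; apply/DE.
  rewrite -(subrK (T x1) (T x)) -addrA (le_trans (ler_normD _ _)) //.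
  rewrite (splitr r) lerD // (le_trans (TT _ _ Dx x1D)) //.
  by rewrite mulrC ler_pM2r ?invr_gt0//; apply/DE.
have half0 : 0 <= (2^-1 : R) by rewrite invr_ge0.
pose X : completeNormedModType R := HB.pack 'rV[R]_n (Complete.on 'rV[R]_n).
have [||//|p /DE Dp Tp] := @banach_fixed_point R X D (mkfun_fun TD).
- exists (NngNum half0); split => /=.
    by rewrite invf_lt1 // ltr1n.
  by move=> [x x'] [/= Dx Dx']; exact: TT.
- exact: closed_ball_closed.
- by exists x1.
exists p => //.
have : (f p - y) *m B = 0.
  move: Tp => /= /eqP; rewrite -[mkfun _ _]/(T p) /T -subr_eq0 opprB addrCA subrr addr0.
  by move/eqP.
move/(congr1 (mulmx^~ J)); rewrite -mulmxA BJ mulmx1 mul0mx.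
by move/eqP; rewrite subr_eq0 => /eqP.
Qed.

Lemma Ck_on_det (V : normedModType R) k (U : set V) n (A : V -> 'M[R]_n) :
  open U -> (forall i j, Ck_on k U (fun x => A x i j : R^o)) ->
  Ck_on k U (fun x => \det (A x) : R^o).
Proof.
move=> oU H; apply: Ck_on_sum => // s.
rewrite (_ : (fun x => _) = ((cst ((-1) ^+ perm.odd_perm s) : V -> R) \*
    (fun x => \prod_i A x i (perm.fun_of_perm s i)) : V -> R^o)) //.
apply: Ck_onM => //.
  exact: Ck_on_cst.
apply: (@Ck_on_prod _ _ k U _ _ _ (fun i x => A x i (perm.fun_of_perm s i))) => //.
Qed.

(** Cramer's rule: the entries of the inverse are cofactors divided by the determinant. *)
Lemma Ck_on_invmx (V : normedModType R) k (U : set V) n (A : V -> 'M[R]_n) :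
  open U -> (forall x, U x -> A x \in unitmx) ->
  (forall i j, Ck_on k U (fun x => A x i j : R^o)) ->
  forall i j, Ck_on k U (fun x => invmx (A x) i j : R^o).
Proof.
move=> oU uA H i j.
have : Ck_on k U (((fun x => (\det (A x))^-1) : V -> R) \*
   (((cst ((-1) ^+ (j + i)) : V -> R) \*
     (fun x => \det (row' j (col' i (A x))))) : V -> R) : V -> R^o).
  apply: Ck_onM => //.
    apply: Ck_onV => //; last exact: Ck_on_det.
    by move=> x /uA; rewrite unitmxE unitfE.
  apply: Ck_onM => //; first exact: Ck_on_cst.
  apply: Ck_on_det => // i' j'.
  rewrite (_ : (fun x => _) = (fun x => A x (lift j i') (lift i j') : R^o)) //.
  by apply/funext => x; rewrite !mxE.
apply: (Ck_on_eq oU) => x Ux.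
by rewrite /invmx uA //= !mxE.
Qed.

(** On a small ball O the bound |f x - f y| >= c |x - y| yields injectivity, invertibility of the
    differential at every point, and continuity of the inverse; [perturbed_linear_onto] at each
    point of O yields openness of the image. *)
Lemma inverse_function n (U : set 'rV[R]_n) (f : 'rV[R]_n -> 'rV[R]_n)
    (x0 : 'rV[R]_n) :
  open U -> U x0 -> smooth_on U f -> (forall v, 'D_v f x0 = 0 -> v = 0) ->
  exists (O : set 'rV[R]_n) (g : 'rV[R]_n -> 'rV[R]_n),
    [/\ open O, O x0 & O `<=` U] /\
    [/\ open (f @` O), forall x, O x -> g (f x) = x & smooth_on (f @` O) g].
Proof.
move=> oU Ux0 sf inj.
have df x : U x -> differentiable f x by exact: smooth_on_diff.
pose J x := jacobian f x.
have DJ x v : U x -> 'D_v f x = v *m J x by move=> /df; exact: deriveEjacobian.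
have /row_freeP[B JB] : row_free (J x0).
  by apply: inj_row_free => v; rewrite -DJ //; exact: inj.
have [C C0 HC] := mulmx_bound B.
have e0 : 0 < (2 * C)^-1 by rewrite invr_gt0 mulr_gt0.
have [d1 d10 [dU Hd]] := strict_derivative oU Ux0 (sf 1%N) e0.
have [c c0 [d2 d20 Hc]] := locally_bounded_below oU Ux0 (sf 1%N) inj.
pose d := Num.min d1 d2.
have d0 : 0 < d by rewrite lt_min d10.
pose O : set 'rV[R]_n := [set x | `|x - x0| < d].
have oO : open O.
  rewrite (_ : O = ball x0 d); first exact: ball_open.
  by apply/seteqP; split => x; rewrite -ball_normE /O /= distrC.
have OU : O `<=` U by move=> x; rewrite /O /= lt_min => /andP[/dU].
have Oexp x y : O x -> O y -> c * `|x - y| <= `|f x - f y|.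
  by rewrite /O /= !lt_min => /andP[_ ?] /andP[_ ?]; exact: Hc.
have fO : open (f @` O).
  rewrite openE => _ [x1 Ox1 <-].
  (* The closed ball of radius r about x1 stays inside O, where the estimate at x0 holds
     uniformly. *)
  pose r := (d - `|x1 - x0|) / 2.
  have r0 : 0 < r by rewrite divr_gt0 // subr_gt0.
  have rO x : `|x - x1| <= r -> O x.
    move=> xr; rewrite /O /= -(subrK x1 x) -addrA (le_lt_trans (ler_normD _ _)) //.
    by move: (Ox1) xr; rewrite /r /O /=; lra.
  suff H : \forall y \near f x1, (f @` O) y by exact: H.
  apply/nbhs_normP; exists (r / (2 * C)); first by rewrite /= divr_gt0 // mulr_gt0.
  move=> y; rewrite /ball_ /= distrC => /ltW Hy.
  have [x x'|x xr fx] := perturbed_linear_onto C0 r0 JB HC _ Hy; last first.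
    by exists x => //; exact: rO.
  move=> /rO + /rO; rewrite /O /= !lt_min => /andP[xd _] /andP[xd' _].
  by rewrite -DJ //; exact: Hd.
pose g y := xget x0 [set x | O x /\ f x = y].
have gP y : (f @` O) y -> O (g y) /\ f (g y) = y.
  move=> [x Ox fx].
  exact: (@xgetPex _ x0 [set x | O x /\ f x = y] (ex_intro _ x (conj Ox fx))).
have Oinj x x' : O x -> O x' -> f x = f x' -> x = x'.
  move=> Ox Ox' E; have := Oexp _ _ Ox Ox'.
  by rewrite E subrr normr0 pmulr_rle0 // normr_le0 subr_eq0 => /eqP.
have gK x : O x -> g (f x) = x.
  by move=> Ox; have [] := gP (f x); [exists x|move=> Og; exact: Oinj].
(* Along a nonzero kernel vector, f would vary by at most c / 2 times a small displacement,
   contradicting the lower bound c on O. *)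
have uJ x : O x -> J x \in unitmx.
  move=> Ox; rewrite -row_free_unit; apply: inj_row_free => v.
  rewrite -DJ; last exact: OU.
  rewrite deriveE; last exact/df/OU.
  move=> dv0; apply/eqP/negP => /negP v0.
  have c2 : 0 < c / 2 by rewrite divr_gt0.
  have /nbhs_norm0P[r /= r0 Hr] := differentiable_bound (df _ (OU _ Ox)) c2.
  have /nbhs_norm0P[r' /= r'0 Hr'] : \forall h \near (0 : 'rV[R]_n), O (h + x).
    have := open_nbhs_nbhs (conj oO Ox); rewrite -[nbhs x O]/(\near x, O x).
    by rewrite (near_shift 0); apply: filterS => h /=; rewrite subr0.
  pose t := (Num.min r r') / 2 / `|v|.
  have v00 : 0 < `|v| by rewrite normr_gt0.
  have rr : 0 < Num.min r r' by rewrite lt_min r0.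
  have t0 : 0 < t by rewrite !divr_gt0.
  have tv : `|t *: v| = Num.min r r' / 2.
    by rewrite normrZ gtr0_norm // /t divfK // gt_eqF.
  have tvr : `|t *: v| < Num.min r r' by rewrite tv; lra.
  move: (tvr); rewrite lt_min => /andP[tr tr'].
  have := Hr _ tr; have := Oexp _ _ (Hr' _ tr') Ox.
  rewrite /= addrK linearZ /= dv0 scaler0 subr0 => H1 H2; have := le_trans H1 H2.
  by rewrite ler_pM2r ?tv ?divr_gt0//; move: c0; lra.
have dg y : (f @` O) y ->
    differentiable g y /\ 'd g y = mulmxr (invmx (J (g y))) :> (_ -> _).
  move=> Hy; have [Ox fx] := gP y Hy; set x := g y in Ox fx *.
  have [K K0 HK] := mulmx_bound (invmx (J x)).
  apply: differentiable_of_bound; first exact: rV_linear_continuous.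
  move=> e ep; pose e' := e * c / K.
  have e'0 : 0 < e' by rewrite divr_gt0 // mulr_gt0.
  have /nbhs_norm0P[r /= r0 Hr] := differentiable_bound (df _ (OU _ Ox)) e'0.
  have Hn : \forall h \near (0 : 'rV[R]_n), (f @` O) (h + y).
    have := open_nbhs_nbhs (conj fO Hy); rewrite -[nbhs y _]/(\near y, (f @` O) y).
    by rewrite (near_shift 0); apply: filterS => h /=; rewrite subr0.
  have Hs : \forall h \near (0 : 'rV[R]_n), `|h| < c * r.
    by apply/nbhs_norm0P; exists (c * r) => //=; rewrite mulr_gt0.
  apply: filterS2 Hn Hs => h Hh hs.
  have [Ox' fx'] := gP _ Hh; set x' := g (h + y) in Ox' fx' *.
  have ck : c * `|x' - x| <= `|h|.
    by have := Oexp _ _ Ox' Ox; rewrite fx' fx addrK.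
  have kr : `|x' - x| < r by rewrite -(ltr_pM2l c0) (le_lt_trans ck).
  have := Hr _ kr; rewrite /= subrK fx fx' addrK -deriveE; last exact/df/OU.
  rewrite DJ; last exact: OU.
  move=> Hk.
  have -> : x' - x - h *m invmx (J x) =
      - ((h - (x' - x) *m J x) *m invmx (J x)).
    by rewrite mulmxBl mulmxK ?uJ// opprB.
  rewrite normrN (le_trans (HK _)) // -ler_pdivlMl // (le_trans Hk) //.
  rewrite /e' -!mulrA [leRHS]mulrCA ler_pM2l // mulrCA ler_pM2l ?invr_gt0//.
exists O, g; split; split => //.
  by rewrite /O /= subrr normr0.
have Dg y v : (f @` O) y -> 'D_v g y = v *m invmx (J (g y)).
  by move=> /dg[dgy E]; rewrite deriveE // E.
(* Bootstrapping: the derivative of g is the inverse Jacobian of f evaluated at g, hence of class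
   C^k as soon as g is. *)
elim => [|k IH].
  by move=> y /[!inE] /dg[/differentiable_continuous].
split => [y /dg[]//|v].
suff : Ck_on k (f @` O) (fun y => v *m invmx (J (g y))).
  by apply: (Ck_on_eq fO) => y Hy; rewrite Dg.
apply: Ck_on_rV => // j.
have : Ck_on k (f @` O) (fun y => \sum_i ((cst (v 0 i) : _ -> R) y * invmx (J (g y)) i j) : R^o).
  apply: Ck_on_sum => // i; apply: Ck_onM => //; first exact: Ck_on_cst.
  apply: Ck_on_invmx => // [y /gP[Og _]|i' j']; first exact: uJ.
  apply: (Ck_on_eq fO (f := (fun x => ('D_(delta_mx 0 i') f x) 0 j' : R^o) \o g)).
    by move=> y /gP[Og _] /=; rewrite DJ ?rowE//; [rewrite -rowE mxE|exact: OU].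
  apply: (Ck_on_comp_R (U' := O)) => //; first by move=> y /gP[].
  apply: Ck_on_coord => //; apply: smooth_on_derive.
  exact: smooth_on_subset OU sf.
apply: (Ck_on_eq fO) => y _; by rewrite !mxE.
Qed.

End inverse_function.

(** * Immersions and submersions in coordinates *)

Section level_sets.
Variable R : realType.

Lemma smooth_on_mulmxr n m (U : set 'rV[R]_n) (B : 'M[R]_(n, m)) :
  open U -> smooth_on U (mulmxr B : 'rV[R]_n -> 'rV[R]_m).
Proof.
by move=> oU; apply: (smooth_on_mulmx (f := id)) => // k; exact: Ck_on_id.
Qed.

(** If B is a right inverse of the Jacobian of h at y0, then y |-> h y B has differential the
    identity there, and its local inverse composed with B is a left inverse of h, smooth on an open
    subset of the ambient space. *)
Lemma local_left_inverse d n (U : set 'rV[R]_d) (h : 'rV[R]_d -> 'rV[R]_n)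
    (y0 : 'rV[R]_d) :
  open U -> U y0 -> smooth_on U h -> (forall v, 'D_v h y0 = 0 -> v = 0) ->
  exists (O : set 'rV[R]_d) (W : set 'rV[R]_n) (s : 'rV[R]_n -> 'rV[R]_d),
    [/\ open O, O y0 & O `<=` U] /\
    [/\ open W, smooth_on W s & forall y, O y -> W (h y) /\ s (h y) = y].
Proof.
move=> oU Uy0 sh inj.
have dh : differentiable h y0 by exact: smooth_on_diff sh Uy0.
have /row_freeP[B JB] : row_free (jacobian h y0).
  by apply: inj_row_free => v; rewrite -deriveEjacobian //; exact: inj.
have cB : continuous (mulmxr B : 'rV[R]_n -> 'rV[R]_d) by exact: rV_linear_continuous.
have [|v|O [g [[oO Oy0 OU] [oI gK sg]]]] :=
    @inverse_function R d U (fun y => h y *m B) y0 oU Uy0.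
- exact: smooth_on_mulmx.
- rewrite (@derive_comp _ _ _ _ h (mulmxr B)) //; last exact: linear_differentiable.
  rewrite deriveE; last exact: linear_differentiable.
  by rewrite diff_lin //= deriveEjacobian // -mulmxA JB mulmx1.
exists O, [set u | ((fun y => h y *m B) @` O) (u *m B)], (g \o mulmxr B).
have oW : open [set u : 'rV[R]_n | ((fun y => h y *m B) @` O) (u *m B)].
  by apply: (open_comp (f := mulmxr B)) => // u _; exact: cB.
split=> //; split=> //.
  by apply: (smooth_on_comp oW oI _ _ sg) => //; exact: smooth_on_mulmxr.
by move=> y Oy; split => /=; [exists y|exact: gK].
Qed.

(** In the Gaussian decomposition of A, the kernel is cut out by the first m rows of the invertible
    matrix [row_ebase A]; the last d rows complete them. *)
Lemma row_free_complement m d (A : 'M[R]_(m, m + d)) : row_free A ->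
  exists Q : 'M[R]_(d, m + d), forall v : 'cV[R]_(m + d),
    A *m v = 0 -> Q *m v = 0 -> v = 0.
Proof.
move=> /eqP rA; exists (dsubmx (row_ebase A)) => v Av Qv.
have : usubmx (row_ebase A *m v) = 0.
  have := mulmx_ebase A; rewrite rA => EA.
  have : col_ebase A *m (pid_mx m *m (row_ebase A *m v)) = 0 by rewrite !mulmxA EA.
  move=> /(congr1 (mulmx (invmx (col_ebase A)))).
  rewrite mulKmx ?col_ebase_unit // mulmx0 pid_mx_row -{1}[row_ebase A *m v]vsubmxK.
  by rewrite mul_row_col mul1mx mul0mx addr0.
move: Qv; rewrite mul_dsub_mx => d0 u0.
have : row_ebase A *m v = 0 by rewrite -[LHS]vsubmxK u0 d0 col_mx0.
by move/(congr1 (mulmx (invmx (row_ebase A)))); rewrite mulKmx ?row_ebase_unit // mulmx0.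
Qed.

(** Completes a submersion to a map with injective differential by adding linear coordinates. *)
Lemma submersion_complement N m d (U : set 'rV[R]_N)
    (g : 'rV[R]_N -> 'rV[R]_m) (u0 : 'rV[R]_N) :
  (m + d = N)%N -> open U -> U u0 -> smooth_on U g ->
  (forall w, exists v, 'D_v g u0 = w) ->
  exists P : 'M[R]_(N, d),
    smooth_on U (fun u => row_mx (g u) (u *m P)) /\
    forall v, 'D_v (fun u => row_mx (g u) (u *m P)) u0 = 0 -> v = 0.
Proof.
move=> mdN; subst N => oU Uu0 sg surj.
have dg : differentiable g u0 by exact: smooth_on_diff sg Uu0.
pose J := jacobian g u0.
have fJ : row_free J^T.
  rewrite /row_free mxrank_tr -[_ == _]/(row_full J).
  rewrite -sub1mx; apply/row_subP => i.
  have [v Hv] := surj (row i 1%:M); rewrite -Hv deriveEjacobian //.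
  exact: submxMl.
have [Q HQ] := row_free_complement fJ.
exists Q^T.
have -> : (fun u => row_mx (g u) (u *m Q^T)) =
    (mulmxr (row_mx 1%:M 0) \o g) \+ mulmxr (row_mx 0 Q^T).
  by apply/funext => u /=; rewrite !mul_mx_row !mulmx1 !mulmx0 add_row_mx addr0 add0r.
split=> [k|v].
  apply: Ck_onD => //; first exact: smooth_on_mulmx.
  exact: smooth_on_mulmxr.
have dlin (q : nat) (A : 'M[R]_(q, m + d)) x : differentiable (mulmxr A : 'rV[R]_q -> _) x.
  by apply: linear_differentiable; exact: rV_linear_continuous.
have DL (q : nat) (A : 'M[R]_(q, m + d)) x w :
    'D_w (mulmxr A : 'rV[R]_q -> _) x = w *m A.
  by rewrite deriveE // diff_lin //; exact: rV_linear_continuous.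
have d1 : differentiable (mulmxr (row_mx 1%:M 0) \o g : _ -> 'rV[R]_(m + d)) u0.
  exact: differentiable_comp.
rewrite (@deriveD _ _ _ (mulmxr (row_mx 1%:M 0) \o g) (mulmxr (row_mx 0 Q^T)));
  [|exact: diff_derivable|exact: diff_derivable].
rewrite derive_comp // !DL !mul_mx_row !mulmx1 !mulmx0 add_row_mx addr0 add0r => E.
have /eq_row_mx[E1 E2] : row_mx ('D_v g u0) (v *m Q^T) = row_mx 0 0.
  by rewrite row_mx0.
apply/trmx_inj; rewrite trmx0; apply: HQ.
  by rewrite -trmx_mul -deriveEjacobian // E1 trmx0.
by rewrite -[Q]trmxK -trmx_mul E2 trmx0.
Qed.

(** In the local coordinates (g u, u P) the level set is {0} x Z. Its chart u |-> u P is the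
    restriction of a linear map, and psi z is the point with coordinates (0, z). *)
Lemma level_set_parametrization N m d (U : set 'rV[R]_N)
    (g : 'rV[R]_N -> 'rV[R]_m) (u0 : 'rV[R]_N) :
  (m + d = N)%N -> open U -> U u0 -> smooth_on U g ->
  (forall w, exists v, 'D_v g u0 = w) ->
  exists (P : 'M[R]_(N, d)) (O : set 'rV[R]_N) (Z : set 'rV[R]_d)
      (psi : 'rV[R]_d -> 'rV[R]_N),
    [/\ open O, O u0 & O `<=` U] /\
    [/\ open Z, smooth_on Z psi,
        forall u, O u -> g u = 0 -> Z (u *m P) /\ psi (u *m P) = u &
        forall z, Z z -> [/\ O (psi z), g (psi z) = 0 & psi z *m P = z]].
Proof.
move=> mdN oU Uu0 sg surj.
have [P [sF iF]] := submersion_complement mdN oU Uu0 sg surj.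
subst N; pose F u := row_mx (g u) (u *m P).
case: (@inverse_function R _ U F u0 oU Uu0 sF iF) => O [G [[oO Ou0 OU] [oI GK sG]]].
pose L : 'M[R]_(d, m + d) := row_mx 0 1%:M.
have LE z : z *m L = row_mx 0 z :> 'rV[R]_(m + d) by rewrite mul_mx_row mulmx0 mulmx1.
exists P, O, [set z | (F @` O) (z *m L)], (G \o mulmxr L).
have oZ : open [set z | (F @` O) (z *m L)].
  by apply: (open_comp (f := mulmxr L)) => // u _; exact: rV_linear_continuous.
split=> //; split=> //.
- by apply: (smooth_on_comp oZ oI _ _ sG) => //; exact: smooth_on_mulmxr.
- move=> u Ou gu; have E : u *m P *m L = F u by rewrite LE /F gu.
  by rewrite /= E; split; [exists u|rewrite GK].
- move=> z [u Ou Fu] /=; rewrite -Fu GK //.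
  by move: Fu; rewrite /F LE => /eq_row_mx[].
Qed.

End level_sets.

(** * Symmetry of second derivatives *)

Section schwarz.
Variables (R : realType) (V : normedModType R).

Lemma derive_scale (f : V -> R^o) (s : R) (u z : V) :
  differentiable f z -> 'D_(s *: u) f z = s * 'D_u f z.
Proof. by move=> df; rewrite !deriveE // linearZ. Qed.

Lemma differentiable_shift (f : V -> R^o) (c z : V) :
  differentiable f (z + c) -> differentiable (fun y => f (y + c)) z /\
  forall u, 'D_u (fun y => f (y + c)) z = 'D_u f (z + c).
Proof.
move=> df.
have ds : is_diff z (fun y : V => y + c) id.
  by have := is_diffD (is_diff_id z) (is_diff_cst c z); rewrite addr0.
have dsz : differentiable (fun y : V => y + c) z by exact: ex_diff.
split; first exact: (@differentiable_comp _ _ _ _ (fun y : V => y + c) f).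
move=> u; rewrite (@derive_comp _ _ _ _ (fun y : V => y + c) f) //.
by rewrite (deriveE u dsz) diff_val.
Qed.

(** Two applications of the mean value theorem: along u to a first difference in the direction v,
    then along v to the derivative of f along u. *)
Lemma second_difference (U : set V) (f : V -> R^o) (x u v : V) (s r : R) :
  (forall z, `|z - x| < r -> U z) -> Ck_on 2 U f ->
  0 <= s -> s * (`|u| + `|v|) < r ->
  exists2 z, `|z - x| <= s * (`|u| + `|v|) &
    f (x + s *: u + s *: v) - f (x + s *: u) - f (x + s *: v) + f x =
    s * s * 'D_v ('D_u f) z.
Proof.
move=> Ur [df /(_ u) [ddf _]] s0 sr.
have near_x (t t' : R) : 0 <= t <= 1 -> 0 <= t' <= 1 ->
    `|x + t *: (s *: u) + t' *: (s *: v) - x| <= s * (`|u| + `|v|).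
  move=> /andP[t0 t1] /andP[t'0 t'1].
  rewrite addrAC [x + _ - x]addrAC subrr add0r (le_trans (ler_normD _ _)) // !normrZ.
  rewrite (ger0_norm t0) (ger0_norm t'0) (ger0_norm s0) mulrDr.
  by rewrite lerD // ler_piMl // mulr_ge0.
have UU t t' : 0 <= t <= 1 -> 0 <= t' <= 1 ->
    U (x + t *: (s *: u) + t' *: (s *: v)).
  by move=> ht ht'; apply: Ur; rewrite (le_lt_trans (near_x _ _ ht ht')).
have i01 : 0 <= (1 : R) <= 1 by rewrite ler01 lexx.
have i00 : 0 <= (0 : R) <= 1 by rewrite ler01 lexx.
pose F z : R^o := f (z + s *: v) - f z.
have U0 t : 0 <= t <= 1 -> U (x + t *: (s *: u)).
  by move=> ht; have := UU t 0 ht i00; rewrite scale0r addr0.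
have U1 t : 0 <= t <= 1 -> U (x + t *: (s *: u) + s *: v).
  by move=> ht; have := UU t 1 ht i01; rewrite scale1r.
have xu : x + s *: u - x = s *: u by rewrite addrC addKr.
have dF t : 0 <= t <= 1 -> differentiable F (x + t *: (s *: u)) /\
    'D_(s *: u) F (x + t *: (s *: u)) =
      s * ('D_u f (x + t *: (s *: u) + s *: v) - 'D_u f (x + t *: (s *: u))).
  move=> ht; have [d1 D1] := differentiable_shift (df _ (U1 t ht)).
  have d0 := df _ (U0 t ht).
  split; first exact: differentiableB.
  rewrite (@deriveB _ _ _ (fun z => f (z + s *: v)) f);
    [|exact: diff_derivable|exact: diff_derivable].
  by rewrite D1 !derive_scale // ?mulrBr//; exact: df _ (U1 t ht).
have [|t ht] := @line_mvt _ _ F (x + s *: u) x.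
  by move=> t ht; rewrite xu; exact: (dF t ht).1.
rewrite xu (dF t ht).2 => E.
have [|t' ht'] := @line_mvt _ _ ('D_u f) (x + t *: (s *: u) + s *: v) (x + t *: (s *: u)).
  move=> t' ht'; rewrite [_ + s *: v - _]addrAC subrr add0r.
  exact/ddf/UU.
rewrite [_ + s *: v - _]addrAC subrr add0r derive_scale; last exact/ddf/UU.
move=> E'; exists (x + t *: (s *: u) + t' *: (s *: v)); first exact: near_x.
by rewrite -mulrA -E' -E /F opprB addrA addrAC.
Qed.

(** The second difference is symmetric in u and v, so the two mixed derivatives agree at points z1
    and z2 as close to x as desired; continuity does the rest. *)
Lemma schwarz (U : set V) (f : V -> R^o) (x u v : V) :
  open U -> U x -> Ck_on 2 U f -> 'D_v ('D_u f) x = 'D_u ('D_v f) x.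
Proof.
move=> oU Ux cf.
have c a b : {for x, continuous ('D_a ('D_b f))}.
  by have [_ /(_ b) [_ /(_ a)]] := cf; apply; rewrite inE.
apply/eqP; rewrite -subr_eq0 -normr_le0; apply/ler_addgt0Pl => e e0.
have e20 : 0 < e / 2 by rewrite divr_gt0.
have /cvgrPdist_le/(_ _ e20)/nbhs_normP[r1 /= r10 H1] := c v u.
have /cvgrPdist_le/(_ _ e20)/nbhs_normP[r2 /= r20 H2] := c u v.
have /nbhs_normP[r3 /= r30 H3] := open_nbhs_nbhs (conj oU Ux).
pose r := Num.min r1 (Num.min r2 r3).
have r0 : 0 < r by rewrite !lt_min r10 r20.
pose k := `|u| + `|v| + 1.
(* The 1 in k allows u = v = 0 and makes [s * (|u| + |v|) < r] strict. *)
have k0 : 0 < k by rewrite ltr_wpDl // addr_ge0.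
pose s := r / k.
have s0 : 0 < s by rewrite divr_gt0.
have sr : s * (`|u| + `|v|) < r.
  by rewrite /s mulrAC ltr_pdivrMr // ltr_pM2l // /k ltrDl.
have rU z : `|z - x| < r -> U z.
  by rewrite !lt_min => /and3P[_ _ zr]; apply: H3; rewrite /= distrC.
have [z1 z1x E1] := second_difference rU cf (ltW s0) sr.
have [|z2 z2x E2] := @second_difference U f x v u s r rU cf (ltW s0).
  by rewrite [`|v| + _]addrC.
have E : 'D_v ('D_u f) z1 = 'D_u ('D_v f) z2.
  have ss : s * s != 0 by rewrite mulf_neq0 // gt_eqF.
  have xuv : x + s *: v + s *: u = x + s *: u + s *: v by rewrite addrAC.
  apply: (@mulfI R _ ss); apply: (etrans (esym E1)); apply: etrans E2; rewrite xuv.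
  have sw (a b b' e' : R) : a - b - b' + e' = a - b' - b + e' by ring.
  exact: sw.
have rr1 : r <= r1 by rewrite /r ge_min lexx.
have rr2 : r <= r2 by rewrite /r !ge_min lexx orbT.
have z1r : `|x - z1| < r1.
  by rewrite distrC; exact: lt_le_trans (le_lt_trans z1x sr) rr1.
have z2r : `|x - z2| < r2.
  by rewrite distrC; apply: lt_le_trans (le_lt_trans z2x _) rr2; rewrite addrC.
have h1 : `|'D_v ('D_u f) x - 'D_v ('D_u f) z1| <= e / 2 by exact: (H1 _ z1r).
have h2 : `|'D_u ('D_v f) x - 'D_u ('D_v f) z2| <= e / 2 by exact: (H2 _ z2r).
rewrite addr0; apply: le_trans (ler_distD ('D_v ('D_u f) z1) _ _) _.
rewrite [leRHS]splitr; apply: lerD; first exact: h1.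
by rewrite E distrC; exact: h2.
Qed.

End schwarz.

(** Differentiating D_{Y'} h = X' o h along Y produces the derivative of h along D_Y Y' plus the
    second derivative of h on (Y, Y'); the latter is symmetric and cancels in the bracket. *)
Lemma related_bracket (R : realType) m n (U : set 'rV[R]_m) (V : set 'rV[R]_n)
    (h : 'rV[R]_m -> 'rV[R]_n) (Y1 Y2 : 'rV[R]_m -> 'rV[R]_m)
    (X1 X2 : 'rV[R]_n -> 'rV[R]_n) (y : 'rV[R]_m) :
  open U -> U y -> (forall z, U z -> V (h z)) ->
  smooth_on U h -> smooth_on U Y1 -> smooth_on U Y2 ->
  smooth_on V X1 -> smooth_on V X2 ->
  (forall z, U z -> 'D_(Y1 z) h z = X1 (h z)) ->
  (forall z, U z -> 'D_(Y2 z) h z = X2 (h z)) ->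
  'D_('D_(Y1 y) Y2 y - 'D_(Y2 y) Y1 y) h y =
  'D_(X1 (h y)) X2 (h y) - 'D_(X2 (h y)) X1 (h y).
Proof.
move=> oU Uy UV sh s1 s2 t1 t2 r1 r2.
have dh z : U z -> differentiable h z by exact: smooth_on_diff.
pose hi i : 'rV[R]_m -> R^o := fun z => h z 0 i.
have shi i : smooth_on U (hi i) by exact: smooth_on_coord.
have dhi i z : U z -> differentiable (hi i) z by exact: smooth_on_diff.
have hiE i w z : U z -> ('D_w h z) 0 i = 'D_w (hi i) z.
  by move=> Uz; rewrite derive_mx ?mxE //; exact/diff_derivable/dh.
have key Y Y' X X' : smooth_on U Y -> smooth_on U Y' -> smooth_on V X' ->
    (forall z, U z -> 'D_(Y z) h z = X (h z)) ->
    (forall z, U z -> 'D_(Y' z) h z = X' (h z)) ->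
  forall i, ('D_(X (h y)) X' (h y)) 0 i =
    'D_('D_(Y y) Y' y) (hi i) y + 'D_(Y y) ('D_(Y' y) (hi i)) y.
  move=> sY sY' sX' rY rY' i.
  have dX' : differentiable X' (h y) by exact: smooth_on_diff sX' (UV _ Uy).
  have dY' : differentiable Y' y by exact: smooth_on_diff sY' Uy.
  rewrite -rY // -derive_comp //; last exact: dh.
  (* Expanding the moving direction [Y' z] along the basis makes the product rule applicable: one
     half of it differentiates Y', the other the partial derivatives of h. *)
  transitivity ('D_(Y y) (fun z => \sum_j ((Y' z 0 j : R) * 'D_(delta_mx 0 j) (hi i) z : R^o)) y).
    rewrite derive_mx; last by apply/diff_derivable/differentiable_comp => //; exact: dh.
    rewrite mxE; apply: near_eq_derive; apply: (near_open_set oU Uy) => z Uz /=.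
    rewrite -rY' // hiE // derive_rV; [by []|exact: dhi].
  have dYj j : derivable (fun z => Y' z 0 j : R^o) y (Y y).
    exact/diff_derivable/(smooth_on_diff (smooth_on_coord j oU sY') Uy).
  have dDj j : differentiable ('D_(delta_mx 0 j) (hi i)) y.
    exact: smooth_on_diff (smooth_on_derive _ (shi i)) Uy.
  rewrite (_ : (fun z => \sum_j _) = \sum_j
     ((fun z => Y' z 0 j : R) * ('D_(delta_mx 0 j) (hi i) : _ -> R))); last first.
    by apply/funext => z; rewrite fct_sumE.
  rewrite derive_sum; last by move=> j; apply: derivableM => //; exact: diff_derivable.
  under eq_bigr => j _ do rewrite (deriveM (dYj j) (diff_derivable (dDj j))).
  rewrite big_split /= addrC; congr (_ + _).
    rewrite derive_rV; last exact: dhi.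
    apply: eq_bigr => j _; rewrite derive_mx ?mxE; last exact: diff_derivable.
    by rewrite -[RHS]/(_ * _) -[LHS]/(_ * _) mulrC.
  rewrite (schwarz (Y' y) (Y y) oU Uy (shi i 2%N)).
  rewrite derive_rV; last exact: smooth_on_diff (smooth_on_derive _ (shi i)) Uy.
  by apply: eq_bigr => j _; rewrite (schwarz _ (Y y) oU Uy (shi i 2%N)).
apply/rowP => i; rewrite hiE // !mxE.
rewrite (key _ _ _ _ s1 s2 t2 r1 r2) (key _ _ _ _ s2 s1 t1 r2 r1).
have -> a b : 'D_(a - b) (hi i) y = 'D_a (hi i) y - 'D_b (hi i) y.
  by rewrite !deriveE ?linearB //; exact: dhi.
have cancel (a b c d : R) : c = d -> a - b = a + c - (b + d) by move=> ->; ring.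
exact/cancel/(schwarz (Y2 y) (Y1 y) oU Uy (shi i 2%N)).
Qed.

(** * Null sets *)

Local Notation null_set := Defs.null_set.

Section null_sets.
Variable R : realType.

Lemma sum_uniq_sub (T : eqType) (s s' : seq T) (F : T -> R) :
  (forall t, 0 <= F t) -> uniq s -> uniq s' -> {subset s <= s'} ->
  \sum_(t <- s) F t <= \sum_(t <- s') F t.
Proof.
move=> F0 us us' ss'; rewrite [leRHS](bigID (mem s)) /=.
rewrite -[X in _ <= X + _]big_filter.
have -> : \sum_(t <- [seq t <- s' | t \in s]) F t = \sum_(t <- s) F t.
  apply: perm_big; apply: uniq_perm => //; first exact: filter_uniq.
  by move=> t; rewrite mem_filter; case: (boolP (t \in s)) => //= /ss'.
by rewrite lerDl sumr_ge0.
Qed.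

Lemma null_set_countable_cover n (A : set 'rV[R]_n) :
  (forall e : R, 0 < e -> exists (T : countType) (D : pred T)
      (c : T -> 'rV[R]_n) (r : T -> R),
    [/\ forall t, 0 <= r t,
        forall x, A x -> exists2 t, D t & cube (c t) (r t) x &
        forall s : seq T, uniq s -> \sum_(t <- s | D t) (2 * r t) ^+ n <= e]) ->
  null_set A.
Proof.
move=> H e e0; have [T [D [c [r [r0 cov bnd]]]]] := H e e0.
exists (fun k => oapp D false (pickle_inv k)).
exists (fun k => oapp c 0 (pickle_inv k)), (fun k => oapp r 0 (pickle_inv k)).
split.
- by move=> k; case: (pickle_inv k) => /=.
- move=> x /cov[t Dt tx]; exists (pickle t) => /=; by rewrite pickleK_inv.
- move=> m; rewrite -(big_mkord (fun k => oapp D false (pickle_inv k))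
    (fun k => (2 * oapp r 0 (pickle_inv k)) ^+ n)).
  rewrite big_mkcond (eq_bigr (fun k => oapp (fun t => if D t then (2 * r t) ^+ n else 0)
    0 (pickle_inv k))); last by move=> k _; case: (pickle_inv k).
  rewrite -big_pmap -big_mkcond; apply: bnd.
  by apply: (pmap_uniq (@pickle_invK T)); rewrite /index_iota iota_uniq.
Qed.

(** Bounding the sums over squares m x m is enough, as every finite set of pairs lies in such a
    square. *)
Lemma null_set_double_cover n (A : set 'rV[R]_n) :
  (forall e : R, 0 < e -> exists (D : nat -> nat -> bool)
      (c : nat -> nat -> 'rV[R]_n) (r : nat -> nat -> R),
    [/\ forall t i, 0 <= r t i,
        forall x, A x -> exists t, exists2 i, D t i & cube (c t i) (r t i) x &
        forall m, \sum_(t < m) \sum_(i < m | D t i) (2 * r t i) ^+ n <= e]) ->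
  null_set A.
Proof.
move=> H; apply: null_set_countable_cover => e /H[D [c [r [r0 cov bnd]]]].
exists (nat * nat)%type, (fun u => D u.1 u.2), (fun u => c u.1 u.2), (fun u => r u.1 u.2).
split=> [u|x /cov[t [i Dti xti]]|s us]; [exact: r0|by exists (t, i)|].
pose m := (\max_(u <- s) (maxn u.1 u.2)).+1.
apply: le_trans (bnd m).
have sm : {subset s <= [seq (t, i) | t <- iota 0 m, i <- iota 0 m]}.
  move=> [t i] us'; apply: allpairs_f; rewrite mem_iota /= add0n /m ltnS;
    by apply: leq_trans (leq_bigmax_seq _ us' _); rewrite //= ?leq_maxl ?leq_maxr.
rewrite big_mkcond; apply: le_trans (sum_uniq_sub _ us _ sm) _.
- by move=> u; case: ifP => // _; rewrite exprn_ge0 // mulr_ge0.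
- by apply: allpairs_uniq; rewrite ?iota_uniq // => -[? ?] [? ?].
rewrite big_allpairs -[in leRHS](big_mkord xpredT
   (fun t => \sum_(i < m | D t i) (2 * r t i) ^+ n)) /index_iota subn0.
apply: ler_sum => t _; rewrite -big_mkcond /=.
by rewrite -(big_mkord (D t) (fun i => (2 * r t i) ^+ n)) /index_iota subn0.
Qed.

Lemma sum_geometric (e : R) m : 0 <= e -> \sum_(t < m) e / 2 ^+ t.+1 <= e.
Proof.
move=> e0; suff -> : \sum_(t < m) e / 2 ^+ t.+1 = e - e / 2 ^+ m.
  by rewrite gerBl divr_ge0 // exprn_ge0.
elim: m => [|m IH]; first by rewrite big_ord0 expr0 divr1 subrr.
rewrite big_ord_recr /= IH exprS.
by field; rewrite expf_neq0.
Qed.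

Lemma null_set_subset n (A B : set 'rV[R]_n) : A `<=` B -> null_set B -> null_set A.
Proof.
by move=> AB HB e e0; have [D [c [r [r0 cov bnd]]]] := HB e e0;
  exists D, c, r; split=> // x /AB/cov.
Qed.

Lemma null_set_empty n : null_set (set0 : set 'rV[R]_n).
Proof.
move=> e e0; exists pred0, (fun=> 0), (fun=> 0); split=> // m.
by rewrite big_pred0 // ltW.
Qed.

Lemma null_set_bigcup n (A : nat -> set 'rV[R]_n) :
  (forall k, null_set (A k)) -> null_set (\bigcup_k A k).
Proof.
move=> H; apply: null_set_double_cover => e e0.
have /choice[q Hq] : forall t, exists q : pred nat * (nat -> 'rV[R]_n) * (nat -> R),
    [/\ forall k, 0 <= q.2 k,
        A t `<=` \bigcup_(k in [set k | q.1.1 k]) cube (q.1.2 k) (q.2 k) &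
        forall m, \sum_(k < m | q.1.1 k) (2 * q.2 k) ^+ n <= e / 2 ^+ t.+1].
  move=> t; have [|D [c [r Hr]]] := H t (e / 2 ^+ t.+1); last by exists (D, c, r).
  by rewrite divr_gt0 // exprn_gt0.
exists (fun t => (q t).1.1), (fun t => (q t).1.2), (fun t => (q t).2).
split=> [t i|x [t _ Atx]|m]; first by have [] := Hq t.
  by have [_ /(_ x Atx)[k /= Dk xk] _] := Hq t; exists t, k.
apply: le_trans (sum_geometric m (ltW e0)).
by apply: ler_sum => t _; have [_ _] := Hq t; apply.
Qed.

Lemma null_setU n (A B : set 'rV[R]_n) : null_set A -> null_set B -> null_set (A `|` B).
Proof.
move=> HA HB; pose C k := if k is 0 then A else B.
apply: (@null_set_subset _ _ (\bigcup_k C k)).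
  by move=> x [Ax|Bx]; [exists 0%N|exists 1%N].
by apply: null_set_bigcup => -[|k].
Qed.

Lemma null_set_bigcup_fin n (I : finType) (A : I -> set 'rV[R]_n) :
  (forall i, null_set (A i)) -> null_set [set x | exists i, A i x].
Proof.
move=> H; apply: (@null_set_subset _ _
    (\bigcup_k (if (pickle_inv k : option I) is Some i then A i else set0))).
  by move=> x [i Aix]; exists (pickle i) => //; rewrite pickleK_inv.
apply: null_set_bigcup => k; case: (pickle_inv k) => [i|]; first exact: H.
exact: null_set_empty.
Qed.

(* In dimension 0 every cube is a point of volume 1. *)
Lemma null_set_dim0 (A : set 'rV[R]_0) : null_set A -> A = set0.
Proof.
move=> H; have [|D [c [r [r0 cov bnd]]]] := H 2^-1; first by rewrite invr_gt0.
apply/seteqP; split=> // x /cov[k /= Dk _].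
have := bnd k.+1; rewrite big_mkcond big_ord_recr /= Dk expr0 => /(le_trans _).
move=> /(_ 1); rewrite lerDr; have h : (1 : R) <= 2^-1 -> False by lra.
by move=> H1; apply/h/H1/sumr_ge0 => i _; case: ifP => // _; rewrite expr0.
Qed.

(** Positive radii are required for grids whose mesh is the radius. Enlarging the cubes costs little
    volume, except in dimension 0, where each cube has volume 1. *)
Lemma null_set_pos_cover n (A : set 'rV[R]_n) (e : R) : (0 < n)%N -> 0 < e ->
  null_set A ->
  exists (D : pred nat) (c : nat -> 'rV[R]_n) (r : nat -> R),
  [/\ forall k, 0 < r k,
      A `<=` \bigcup_(k in [set k | D k]) cube (c k) (r k) &
      forall m, \sum_(k < m | D k) (2 * r k) ^+ n <= e].
Proof.
move=> n0 e0 H; have [|D [c [r [r0 cov bnd]]]] := H (e / 2); first exact: divr_gt0.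
(* The bound 1 makes each new side s k at most 1, so its volume is at most s k; the bound e / 2
   controls the sum of all s k. *)
pose d : R := Num.min 1 (e / 2).
have d0 : 0 < d by rewrite lt_min ltr01 divr_gt0.
pose s k := d / 2 ^+ k.+1.
have s0 k : 0 < s k by rewrite divr_gt0 // exprn_gt0.
have s1 k : s k <= 1.
  rewrite ler_pdivrMr ?exprn_gt0// mul1r (@le_trans _ _ 1) ?ge_min ?lexx//.
  by rewrite exprn_ege1 // ler1n.
exists D, c, (fun k => Num.max (r k) (s k / 2)); split.
- by move=> k; rewrite lt_max [0 < s k / 2]divr_gt0 ?orbT.
- move=> x /cov[k Dk xk]; exists k => // j.
  by rewrite (le_trans (xk j)) // le_max lexx.
move=> m; apply: (@le_trans _ _ (\sum_(k < m | D k) ((2 * r k) ^+ n + s k))).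
  apply: ler_sum => k _; rewrite /Num.max; case: ifP => _.
    rewrite mulrCA mulfV // mulr1; apply: (@le_trans _ _ (s k)).
      by rewrite -(prednK n0) exprS ler_piMr ?exprn_ile1 // ltW.
    by rewrite lerDr exprn_ge0 // mulr_ge0.
  by rewrite lerDl ltW.
rewrite big_split /= (splitr e) lerD //; first exact: bnd.
apply: (@le_trans _ _ (\sum_(k < m) s k)).
  by rewrite [leLHS]big_mkcond; apply: ler_sum => k _; case: ifP => // _; exact: ltW.
by rewrite (le_trans (sum_geometric m (ltW d0))) // ge_min lexx orbT.
Qed.

(** The pieces B t need not be cubes: h t cuts each of them into at most N t classes of diameter at
    most r t, and a class lies in the cube of radius r t about any of its points. *)
Lemma null_set_covers n (A : set 'rV[R]_n) :
  (forall e : R, 0 < e -> exists (D : pred nat) (B : nat -> set 'rV[R]_n)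
      (N : nat -> nat) (h : forall t : nat, 'rV[R]_n -> nat) (r : nat -> R),
    [/\ forall t, 0 <= r t,
        forall x, A x -> exists2 t, D t & B t x,
        forall t x, B t x -> (h t x < N t)%N,
        forall t x y, B t x -> B t y -> h t x = h t y -> `|x - y| <= r t &
        forall m, \sum_(t < m | D t) (N t)%:R * (2 * r t) ^+ n <= e]) ->
  null_set A.
Proof.
move=> H; apply: null_set_double_cover => e /H[D [B [N [h [r [r0 cov hN hr bnd]]]]]].
exists (fun t i => D t && (i < N t)%N).
(* The centre is an arbitrary point of the class; an empty class receives the default centre 0. *)
exists (fun t i => xget 0 [set x | B t x /\ h t x = i]), (fun t _ => r t).
split=> //.
  move=> x /cov[t Dt Btx]; exists t, (h t x); first by rewrite Dt hN.
  have [By hy] := @xgetPex _ (0 : 'rV[R]_n) [set y | B t y /\ h t y = h t x]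
    (ex_intro _ x (conj Btx erefl)).
  set y := xget _ _ in By hy * => j.
  apply: le_trans (hr t x y Btx By (esym hy)).
  by have := rV_coord_le (x - y) j; rewrite !mxE.
move=> m; apply: le_trans (bnd m); rewrite [leRHS]big_mkcond.
apply: ler_sum => t _; case: (D t) => /=; last by rewrite big_pred0.
rewrite sumr_const -[leLHS]mulr_natl ler_wpM2r // ?exprn_ge0 ?mulr_ge0 // ler_nat.
rewrite -sum1_card -(big_mkord (fun i => (i < N t)%N) (fun=> 1%N)) sum1_count.
rewrite -size_filter; have u : uniq [seq i <- index_iota 0 m | (i < N t)%N].
  by rewrite filter_uniq // iota_uniq.
rewrite -[leqRHS](size_iota 0); apply: uniq_leq_size => // i.
by rewrite mem_filter mem_iota add0n /= => /andP[].
Qed.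

(* [row_mx h P] is bounded below near [y0]; a cube of radius [r] of the cover
   of [N] pulls back to at most (C/r + 1)^k sets of diameter 2r/c, one for each
   cell of a grid of mesh 2r in the complementary coordinates. *)
Lemma null_preimage_submersion m n (U : set 'rV[R]_m)
    (h : 'rV[R]_m -> 'rV[R]_n) (y0 : 'rV[R]_m) (N : set 'rV[R]_n) :
  open U -> U y0 -> smooth_on U h -> (forall w, exists v, 'D_v h y0 = w) ->
  null_set N ->
  exists V : set 'rV[R]_m,
    [/\ open V, V y0, V `<=` U & null_set [set y | V y /\ N (h y)]].
Proof.
move=> oU Uy0 sh surj nN.
have dh : differentiable h y0 by exact: smooth_on_diff sh Uy0.
(* In target dimension 0 a null set is empty; otherwise a cover by cubes of positive radius
   exists. *)
have [n0|n0] := posnP n.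
  subst n; exists U; split=> //.
  by rewrite (null_set_dim0 nN); apply: null_set_subset (null_set_empty m) => y [].
have nm : (n <= m)%N.
  have fJ : row_full (jacobian h y0).
    rewrite -sub1mx; apply/row_subP => i.
    have [v Hv] := surj (row i 1%:M); rewrite -Hv deriveEjacobian //.
    exact: submxMl.
  by rewrite -(eqP fJ) rank_leq_row.
pose k := (m - n)%N.
have nk : (n + k = m)%N by rewrite subnKC.
have [P [sF iF]] := submersion_complement nk oU Uy0 sh surj.
set F := fun u => _ in sF iF.
have [c c0 [d d0 Hd]] := locally_bounded_below oU Uy0 (sF 1%N) iF.
have [C C0 HC] := mulmx_bound P.
(* Radius d keeps the lower bound c valid; radius 1 bounds the complementary coordinates by C. *)
pose rho := Num.min d 1.
have rho0 : 0 < rho by rewrite lt_min d0 ltr01.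
pose V : set 'rV[R]_m := [set y | U y /\ `|y - y0| < rho].
exists V; split.
- rewrite (_ : V = U `&` ball y0 rho); first by apply: openI => //; exact: ball_open.
  by apply/seteqP; split => x; rewrite -ball_normE /V /= distrC.
- by split=> //; rewrite subrr normr0.
- by move=> y [].
apply: null_set_covers => e e0.
(* At most (C / r + 1)^k cubes of side 4 r / c are used. Their volume splits into ((C / r + 1) 4 r /
   c)^k, at most (4 / c (C + 1))^k when r <= 1, and (4 r / c)^n = (2 / c)^n (2 r)^n. *)
pose K := (4 / c * (C + 1)) ^+ k * (2 / c) ^+ n.
have K0 : 0 < K.
  apply: mulr_gt0; apply: exprn_gt0; last exact: divr_gt0.
  by apply: mulr_gt0; [exact: divr_gt0|exact: addr_gt0].
(* The bound 1 on the total volume forces 2 r t <= 1 for every cube in use. *)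
pose e' := Num.min 1 (e / K).
have e'0 : 0 < e' by rewrite lt_min ltr01 divr_gt0.
have [D [ct [r [r0 cov bnd]]]] := null_set_pos_cover n0 e'0 nN.
pose M t := (Num.truncn (C / r t)).+1.
(* Adding C makes the complementary coordinates nonnegative, so that truncation to a natural number
   labels the grid cells. *)
pose s y (j : 'I_k) := ((y - y0) *m P) 0 j + C.
have sV y j : V y -> 0 <= s y j <= 2 * C.
  move=> [_]; rewrite lt_min => /andP[_ y1].
  have : `|((y - y0) *m P) 0 j| <= C.
    rewrite (le_trans (rV_coord_le _ _)) // (le_trans (HC _)) //.
    by rewrite ler_piMr // ltW.
  by rewrite ler_norml /s; move: (_ 0 j) => a; lra.
have sM t y j : V y -> (Num.truncn (s y j / (2 * r t)) < M t)%N.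
  move=> /(sV _ j) /andP[_ s2]; rewrite /M ltnS; apply: le_truncn.
  by rewrite ler_pdivrMr ?mulr_gt0 // mulrCA divfK ?gt_eqF.
pose q t y : {ffun 'I_k -> 'I_(M t)} :=
  [ffun j => inord (Num.truncn (s y j / (2 * r t)))].
exists D, (fun t => [set y | V y /\ cube (ct t) (r t) (h y)]).
exists (fun t => #|{: {ffun 'I_k -> 'I_(M t)}}|), (fun t y => nat_of_ord (enum_rank (q t y))).
exists (fun t => 2 * r t / c); split.
- by move=> t; rewrite divr_ge0 ?mulr_ge0 // ltW.
- by move=> y [Vy /cov[t Dt yt]]; exists t.
- by move=> t y _; exact: ltn_ord.
- move=> t y y' [Vy hy] [Vy' hy'] /val_inj/enum_rank_inj qq.
  have yd z : V z -> `|z - y0| < d by move=> [_]; rewrite lt_min => /andP[].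
  rewrite ler_pdivlMr // mulrC; apply: le_trans (Hd _ _ (yd _ Vy) (yd _ Vy')) _.
  have r20 : 0 < 2 * r t by rewrite mulr_gt0.
  apply: rV_norm_le => [|j]; first exact: ltW.
  rewrite /F !mxE; case: splitP => i _.
    have := hy i; have := hy' i; rewrite !ler_norml.
    by move: (h y 0 i) (h y' 0 i) (ct t 0 i) (r t) => a b a' b'; lra.
  have E : (y *m P) 0 i - (y' *m P) 0 i = s y i - s y' i.
    by rewrite /s !mulmxBl !mxE; ring.
  rewrite -/((y *m P) 0 i) E.
  move/ffunP/(_ i): qq; rewrite !ffunE => /(congr1 val) /=.
  rewrite !inordK ?sM // => T.
  have /andP[si0 _] := sV y i Vy; have /andP[si0' _] := sV y' i Vy'.
  have a0 : 0 <= s y i / (2 * r t) by rewrite divr_ge0 // ltW.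
  have a0' : 0 <= s y' i / (2 * r t) by rewrite divr_ge0 // ltW.
  have /andP[l1 u1] := truncn_itv a0; have /andP[l2 u2] := truncn_itv a0'.
  rewrite T in l1 u1.
  have : `|s y i / (2 * r t) - s y' i / (2 * r t)| <= 1.
    move: u1 u2; rewrite -[X in _ < X -> _]natr1 -[X in _ -> _ < X -> _]natr1.
    move: l1 l2; move: (s y i / _) (s y' i / _) (_%:R) => a b a'.
    by rewrite ler_norml; clear; lra.
  by rewrite -mulrBl normrM normfV (gtr0_norm r20) ler_pdivrMr // mul1r.
move=> m'; apply: (@le_trans _ _ (\sum_(t < m' | D t) K * (2 * r t) ^+ n)); last first.
  rewrite -mulr_sumr mulrC -ler_pdivlMr // (le_trans (bnd m')) //.
  by rewrite ge_min lexx orbT.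
apply: ler_sum => t Dt.
have r1 : 2 * r t <= 1.
  rewrite -(expr_le1 n0) ?mulr_ge0 ?(ltW (r0 t))//.
  apply: (@le_trans _ _ e'); last by rewrite ge_min lexx.
  apply: le_trans (bnd t.+1); rewrite big_mkcond big_ord_recr /= Dt lerDr.
  by apply: sumr_ge0 => i _; case: ifP => // _; rewrite exprn_ge0 // mulr_ge0 // ltW.
rewrite card_ffun !card_ord natrX -nk exprD /K.
have -> : 2 * (2 * r t / c) = 4 / c * r t by field; rewrite gt_eqF.
have E1 : (4 / c * r t) ^+ n = (2 / c) ^+ n * (2 * r t) ^+ n.
  by rewrite -exprMn; congr (_ ^+ _); field; rewrite gt_eqF.
have X0 : 0 < (2 / c) ^+ n * (2 * r t) ^+ n.
  by apply: mulr_gt0; apply: exprn_gt0; [exact: divr_gt0|exact: mulr_gt0].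
rewrite E1 -[leRHS]mulrA mulrCA [leRHS]mulrC ler_pM2l //.
rewrite -exprMn mulrCA; apply: lerXn2r.
- by rewrite nnegrE !mulr_ge0 // ?invr_ge0 ltW.
- by rewrite nnegrE !mulr_ge0 ?addr_ge0 ?invr_ge0 // ltW.
rewrite ler_pM2l ?divr_gt0 // /M -natr1 mulrDl mul1r lerD //; last first.
  by move: (r0 t) r1; lra.
by rewrite -ler_pdivlMr // truncn_le divr_ge0 // ltW.
Qed.

End null_sets.

(** * Products and subspaces *)

Section topology.

Lemma choice_dep (I : Type) (T : I -> Type) (P : forall i, T i -> Prop) :
  (forall i, exists t, P i t) -> exists t : forall i, T i, forall i, P i (t i).
Proof.
by move=> H; exists (fun i => sval (cid (H i))) => i; exact: svalP (cid (H i)).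
Qed.

Lemma open_preimage_in (T T' : topologicalType) (U : set T) (f : T -> T')
    (O : set T') :
  open U -> {in U, continuous f} -> open O -> open (U `&` f @^-1` O).
Proof.
move=> oU cf oO; rewrite openE => x [Ux Ofx].
apply: filterI; first exact: open_nbhs_nbhs (conj oU Ux).
by apply: (cf x (mem_set Ux)); exact: open_nbhs_nbhs (conj oO Ofx).
Qed.

(** The product topology is a supremum of initial topologies, so convergence to x of the filter
    generated by open boxes can be checked one coordinate at a time. *)
Lemma nbhs_prod_box (I : eqType) (K : I -> topologicalType)
    (x : prod_topology K) (A : set (prod_topology K)) :
  nbhs x A -> exists V : forall i, set (K i),
    (forall i, open (V i) /\ V i (x i)) /\ [set y | forall i, V i (y i)] `<=` A.
Proof.
pose F := filter_from
  [set V : forall i, set (K i) | forall i, open (V i) /\ V i (x i)]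
  (fun V => [set y : prod_topology K | forall i, V i (y i)]).
have FF : Filter F.
  apply: filter_from_filter; first by exists (fun=> setT) => i; split=> //; exact: openT.
  move=> V W HV HW; exists (fun i => V i `&` W i).
    by move=> i; have [oV Vx] := HV i; have [oW Wx] := HW i; split=> //; exact: openI.
  by move=> y Hy; split=> i; have [] := Hy i.
suff H : F --> x by move=> /H[V HV VA]; exists V.
apply/cvg_sup => i B [_ [[W oW <-]] /= Wx /filterS]; apply.
exists (dfwith (fun j => [set: K j]) i W).
  by move=> j; case: dfwithP => // k _; split=> //; exact: openT.
by move=> y /(_ i); rewrite dfwithin.
Qed.

Lemma nbhs_box (I : finType) (K : I -> topologicalType) (x : prod_topology K)
    (V : forall i, set (K i)) :
  (forall i, nbhs (x i) (V i)) -> nbhs x [set y | forall i, V i (y i)].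
Proof.
move=> H; apply: (filter_forall (nbhs_filter x)) => i.
exact: (@proj_continuous I K i x _ (H i)).
Qed.

Lemma open_box (I : finType) (K : I -> topologicalType)
    (V : forall i, set (K i)) :
  (forall i, open (V i)) -> open [set y : prod_topology K | forall i, V i (y i)].
Proof.
move=> oV; rewrite openE => y Vy; apply: nbhs_box => i.
exact: open_nbhs_nbhs (conj (oV i) (Vy i)).
Qed.

Lemma continuous_at_prod (T : topologicalType) (I : finType)
    (K : I -> topologicalType) (f : T -> prod_topology K) (z : T) :
  (forall i, {for z, continuous (fun t => f t i : K i)}) -> {for z, continuous f}.
Proof.
move=> cf A /nbhs_prod_box[V [HV VA]].
have : \forall t \near z, forall i, V i (f t i).
  by apply: (filter_forall (nbhs_filter z)) => i; apply: cf; exact: open_nbhs_nbhs.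
by apply: filterS => t /VA.
Qed.

Lemma set_val_continuous (T : topologicalType) (A : set T) :
  continuous (set_val : A -> T).
Proof. exact: initial_continuous. Qed.

Lemma open_set_val (T : topologicalType) (A U : set T) :
  open U -> open ((set_val : A -> T) @^-1` U).
Proof. by move=> oU; apply: open_comp => // z _; exact: set_val_continuous. Qed.

Lemma continuous_at_set_type (T X : topologicalType) (A : set X) (f : T -> A)
    (z : T) :
  {for z, continuous (set_val \o f)} -> {for z, continuous f}.
Proof.
move=> cf U [_ [[W oW <-]] /= Wfz /filterS]; apply; apply: cf.
exact: open_nbhs_nbhs.
Qed.

Lemma hausdorff_set_type (X : topologicalType) (A : set X) :
  hausdorff_space X -> hausdorff_space A.
Proof.
rewrite !open_hausdorff => H x y xy.
have [[U V] /= [xU yV] [oU oV /eqP UV]] : exists2 AB,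
    (set_val x \in AB.1 /\ set_val y \in AB.2) &
    [/\ open AB.1, open AB.2 & AB.1 `&` AB.2 == set0].
  by apply: H; apply: contra xy => /eqP/val_inj ->.
exists (set_val @^-1` U, set_val @^-1` V) => /=.
  by rewrite !inE /=; rewrite !inE in xU yV.
split; [exact: open_set_val|exact: open_set_val|].
by rewrite -preimage_setI UV preimage_set0.
Qed.

Lemma countable_enum (T : Type) (B : set T) (t0 : T) :
  countable B -> exists e : nat -> T, B `<=` range e.
Proof.
move=> /pfcard_geP[->|[f]]; first by exists (fun=> t0).
by exists f => b Bb; have [n _ <-] := @surj _ _ _ _ f b Bb; exists n.
Qed.

Lemma second_countable_set_type (X : topologicalType) (A : set X) :
  @second_countable X -> @second_countable A.
Proof.
move=> [B cB [Bo Bn]]; exists [set (set_val : A -> X) @^-1` U | U in B].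
  exact: card_le_trans (card_image_le _ _) cB.
split=> [_ [U BU <-]|x V [_ [[W oW <-]] /= Wx WV]].
  by apply: open_set_val; exact: Bo.
have [U [BU Ux] UW] := Bn (set_val x) W (open_nbhs_nbhs (conj oW Wx)).
exists (set_val @^-1` U) => /=; first by split=> //; exists U.
by move=> y Uy; apply: WV; exact: UW.
Qed.

Lemma second_countable_prod (I : finType) (K : I -> topologicalType) :
  (forall i, @second_countable (K i)) -> @second_countable (prod_topology K).
Proof.
move=> H.
have /choice_dep[q Hq] : forall i, exists q : nat -> set (K i),
    forall x V, nbhs x V -> exists n, [/\ open (q n), q n x & q n `<=` V].
  move=> i; have [B cB [Bo Bn]] := H i.
  have [e Be] := countable_enum set0 cB; exists e => x V /Bn[U [BU Ux] UV].
  by have [n _ en] := Be U BU; exists n; rewrite en; split=> //; exact: Bo.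
pose box (s : {ffun I -> nat}) := [set y : prod_topology K | forall i, q i (s i) (y i)].
(* The enumerations q i may also take values outside the bases, so only boxes with open sides are
   retained; finite functions to nat keep the family countable. *)
exists [set box s | s in [set s : {ffun I -> nat} | forall i, open (q i (s i))]].
  exact: card_le_trans (card_image_le _ _) (countableP _).
split=> [_ [s os <-]|x V /nbhs_prod_box[W [HW WV]]].
  exact: (@open_box I K (fun i => q i (s i))).
have /choice_dep[n Hn] : forall i, exists n,
    [/\ open (q i n), q i n (x i) & q i n `<=` W i].
  by move=> i; apply: Hq; exact: open_nbhs_nbhs.
exists (box [ffun i => n i]) => /=.
  split; last by move=> i; rewrite ffunE; have [] := Hn i.
  by exists [ffun i => n i] => // i; rewrite ffunE; have [] := Hn i.
move=> y Hy; apply: WV => i; have [_ _] := Hn i; apply.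
by have := Hy i; rewrite ffunE.
Qed.

(** A Lindelof argument: countably many basic open sets U for which the image of U and A together is
    null already cover A. *)
Lemma null_set_local (R : realType) d (T : topologicalType) (A : set T)
    (m : T -> 'rV[R]_d) :
  @second_countable T ->
  (forall x, A x -> exists O, [/\ open O, O x & null_set (m @` (O `&` A))]) ->
  null_set (m @` A).
Proof.
move=> [B cB [_ Bn]] H.
pose G := [set U | B U /\ null_set (m @` (U `&` A))].
have cG : countable G by apply: sub_countable cB; apply: subset_card_le => U [].
have [e Ge] := countable_enum set0 cG.
apply: (@null_set_subset _ _ _ (\bigcup_k
   (if pselect (G (e k)) then m @` (e k `&` A) else set0))); last first.
  apply: null_set_bigcup => k; case: pselect => /= [[]//|_]; exact: null_set_empty.
move=> _ [x Ax <-]; have [W [oW Wx nW]] := H x Ax.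
have [U [BU Ux] UO] := Bn x W (open_nbhs_nbhs (conj oW Wx)).
have GU : G U.
  split=> //; apply: null_set_subset nW => _ [y [Uy Ay] <-].
  by exists y => //; split=> //; exact: UO.
have [k _ ek] := Ge U GU; exists k => //.
by rewrite ek; case: pselect => /= [_|[]//]; exists x.
Qed.

End topology.

(** * Linear independence *)

Section wedge.
Variables (R : realType) (J : finType) (n : nat).
Implicit Types v : J -> 'rV[R]_n.

(** The solution is supported on the columns of a nonzero minor. With [solve_indep] and
    [indep_wedge_neq0] this closes a cycle: nonzero wedge, prescribed values attained, linear
    independence. *)
Lemma wedge_neq0_solve v : wedge_neq0 v ->
  forall t : J -> R, exists u : 'rV[R]_n, forall j, \sum_l u 0 l * v j 0 l = t j.
Proof.
move=> [s ds] t; set A := \matrix_(a, b) _ in ds.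
have uA : A \in unitmx by rewrite unitmxE unitfE.
pose x : 'cV[R]_#|J| := invmx A *m \col_a t (enum_val a).
have Ax : A *m x = \col_a t (enum_val a) by rewrite mulKVmx.
exists (\sum_b x b 0 *: delta_mx 0 (s b)) => j.
transitivity (\sum_b x b 0 * v j 0 (s b)).
  under eq_bigr => l _ do rewrite summxE mulr_suml.
  rewrite exchange_big /=; apply: eq_bigr => b _; move: (x b 0) => xb.
  rewrite (bigD1 (s b)) //= !mxE !eqxx mulr1 big1 ?addr0 // => l ls.
  by rewrite !mxE (negPf ls) mulr0 mul0r.
have := congr1 (fun M : 'cV[R]__ => M (enum_rank j) 0) Ax; rewrite !mxE enum_rankK => <-.
by apply: eq_bigr => b _; rewrite !mxE enum_rankK mulrC.
Qed.

Lemma solve_indep v (c : J -> R) :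
  (forall t : J -> R, exists u : 'rV[R]_n, forall j, \sum_l u 0 l * v j 0 l = t j) ->
  \sum_j c j *: v j = 0 -> forall j, c j = 0.
Proof.
move=> H cv j; have [u Hu] := H (fun j' => (j' == j)%:R).
have : \sum_j' c j' * (\sum_l u 0 l * v j' 0 l) = 0.
  transitivity (\sum_l u 0 l * (\sum_j' c j' *: v j') 0 l); last first.
    by rewrite cv big1 // => l _; rewrite mxE mulr0.
  rewrite [RHS](eq_bigr (fun l => \sum_j' c j' * (u 0 l * v j' 0 l))); last first.
    move=> l _; rewrite summxE mulr_sumr; apply: eq_bigr => j' _.
    by rewrite mxE mulrCA.
  by rewrite exchange_big; apply: eq_bigr => j' _; rewrite mulr_sumr.
rewrite (bigD1 j) //= Hu eqxx mulr1 big1 ?addr0 // => j' jj'.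
by rewrite Hu (negPf jj') mulr0.
Qed.

(** Row rank equals column rank, so as many independent columns as vectors can be selected; they
    form the nonzero minor. *)
Lemma indep_wedge_neq0 v :
  (forall c : J -> R, \sum_j c j *: v j = 0 -> forall j, c j = 0) -> wedge_neq0 v.
Proof.
move=> H; pose A : 'M[R]_(#|J|, n) := \matrix_(a, l) v (enum_val a) 0 l.
have fA : row_free A.
  apply: inj_row_free => c cA; apply/rowP => a; rewrite mxE -(enum_valK a).
  apply: (H (fun j => c 0 (enum_rank j))); apply/rowP => l.
  transitivity ((c *m A) 0 l); last by rewrite cA.
  rewrite summxE mxE (reindex (fun b : 'I_#|J| => enum_val b)) /=; last first.
    by exists enum_rank => ? _; [exact: enum_valK|exact: enum_rankK].
  by apply: eq_bigr => b _; rewrite !mxE enum_valK.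
have fAT : row_full A^T by rewrite /row_full mxrank_tr.
exists (fullrankfun fAT).
suff : rowsub (fullrankfun fAT) A^T \in unitmx.
  rewrite unitmxE unitfE -det_tr; congr (\det _ != 0).
  by apply/matrixP => a b; rewrite !mxE.
by rewrite -row_free_unit -row_leq_rank mxrank_fullrowsub.
Qed.

Lemma solve_wedge_neq0 v :
  (forall t : J -> R, exists u : 'rV[R]_n, forall j, \sum_l u 0 l * v j 0 l = t j) ->
  wedge_neq0 v.
Proof. by move=> H; apply: indep_wedge_neq0 => c; exact: solve_indep. Qed.

End wedge.

(** * Charts of products and of submanifolds *)

Section charts.
Variables (R : realType) (T : topologicalType) (n : nat) (c : chart R T n).
Hypothesis hc : is_chart c.

Lemma chart_cinvK u : cimg c u -> cdom c (cinv c u) /\ cmap c (cinv c u) = u.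
Proof. by case: hc => _ _ K _ _ [x Dx <-]; rewrite K. Qed.

(** Turns a direct image into an inverse image, whose openness follows from continuity of [cinv]. *)
Lemma chart_imageE (O : set T) :
  cmap c @` (cdom c `&` O) = cimg c `&` cinv c @^-1` O.
Proof.
case: (hc) => _ _ K _ _; apply/seteqP; split=> [_ [x [Dx Ox] <-]|u [Iu Ou]].
  by split; [exists x|rewrite /= K].
by have [Dx xu] := chart_cinvK Iu; exists (cinv c u).
Qed.

Lemma chart_image_open (O : set T) : open O -> open (cmap c @` (cdom c `&` O)).
Proof.
by case: (hc) => _ oI _ _ ci oO; rewrite chart_imageE; exact: open_preimage_in.
Qed.

Lemma chart_preimage_open (V : set 'rV[R]_n) :
  open V -> open (cdom c `&` cmap c @^-1` V).
Proof. by case: (hc) => oD _ _ cm _ oV; exact: open_preimage_in. Qed.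

End charts.

Section blocks.
Variables (R : realType) (I : finType) (n : I -> nat).

(** Right multiplication by this matrix is [block i] and by its transpose [to_block], which puts
    both under the general results on linear maps. *)
Definition block_mx_proj (i : I) : 'M[R]_(pdim n, n i) :=
  \matrix_(k, j) (k == enum_rank (Tagged (fun i => 'I_(n i)) j))%:R.

Lemma blockE i (u : 'rV[R]_(pdim n)) : block i u = u *m block_mx_proj i.
Proof.
apply/rowP => j; rewrite !mxE (bigD1 (enum_rank (Tagged (fun i => 'I_(n i)) j))) //=.
by rewrite !mxE eqxx mulr1 big1 ?addr0 // => k kj; rewrite mxE (negPf kj) mulr0.
Qed.

Lemma to_blockE i (v : 'rV[R]_(n i)) : to_block v = v *m (block_mx_proj i)^T.
Proof.
apply/rowP => k; rewrite /to_block summxE !mxE; apply: eq_bigr => j _.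
by rewrite !mxE eqxx.
Qed.

Lemma block_sum i (v : forall i, 'rV[R]_(n i)) :
  block i (\sum_i' to_block (v i')) = v i.
Proof.
rewrite blockE mulmx_suml (bigD1 i) //= -blockE block_to_block.
rewrite big1 ?addr0 // => j ji; rewrite -blockE block_to_block_neq //.
by rewrite eq_sym.
Qed.

Lemma block_inj (u u' : 'rV[R]_(pdim n)) :
  (forall i, block i u = block i u') -> u = u'.
Proof.
move=> H; apply/rowP => k; rewrite -(enum_valK k); case: (enum_val k) => i j.
by have := congr1 (fun v : 'rV[R]_(n i) => v 0 j) (H i); rewrite !mxE.
Qed.

Lemma sum_block (u : 'rV[R]_(pdim n)) : u = \sum_i to_block (block i u).
Proof. by apply: block_inj => i; rewrite block_sum. Qed.

Lemma block_continuous i : continuous (@block R I n i).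
Proof.
rewrite (_ : @block R I n i = mulmxr (block_mx_proj i)).
  exact: rV_linear_continuous.
by apply/funext => u; rewrite blockE.
Qed.

Lemma to_block_continuous i : continuous (@to_block R I n i).
Proof.
rewrite (_ : @to_block R I n i = mulmxr (block_mx_proj i)^T).
  exact: rV_linear_continuous.
by apply/funext => u; rewrite to_blockE.
Qed.

End blocks.

Lemma derive_mulmx (R : realType) (V : normedModType R) n m
    (f : V -> 'rV[R]_n) (B : 'M[R]_(n, m)) (x v : V) :
  differentiable f x ->
  differentiable (fun z => f z *m B) x /\ 'D_v (fun z => f z *m B) x = 'D_v f x *m B.
Proof.
move=> df; have dB y : differentiable (mulmxr B : 'rV[R]_n -> 'rV[R]_m) y.
  by apply: linear_differentiable; exact: rV_linear_continuous.
split; first exact: (@differentiable_comp _ _ _ _ f (mulmxr B)).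
rewrite (@derive_comp _ _ _ _ f (mulmxr B)) // deriveE // diff_lin //.
exact: rV_linear_continuous.
Qed.

Lemma continuous_at_sum (R : realType) (T : topologicalType)
    (V : normedModType R) (I : finType) (f : I -> T -> V) (x : T) :
  (forall i, {for x, continuous (f i)}) ->
  {for x, continuous (fun y => \sum_i f i y)}.
Proof.
move=> cf; elim: (index_enum I) => [|i r IH].
  rewrite (_ : (fun y => _) = cst 0); first exact: cst_continuous.
  by apply/funext => y; rewrite big_nil.
rewrite (_ : (fun y => _) = f i \+ (fun y => \sum_(j <- r) f j y)).
  exact: continuousD.
by apply/funext => y; rewrite big_cons.
Qed.

Section products.
Variables (R : realType) (I : finType) (n : I -> nat).
Variables (M : forall i, charted_space R (n i)).
Hypothesis hM : forall i, is_manifold (M i).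
Implicit Types (B : chart_idx (prod_space M)).

Lemma prod_cimgE B : cimg B = [set u | forall i, cimg (B i) (block i u)].
Proof.
apply/seteqP; split=> [_ [x Dx <-] i|u Hu].
  by rewrite /= block_sum; exists (x i).
exists (fun i => cinv (B i) (block i u)) => [i|].
  by have [] := chart_cinvK (manifold_chart (hM i) (B i)) (Hu i).
rewrite [RHS]sum_block /=; apply: eq_bigr => i _.
by have [_ ->] := chart_cinvK (manifold_chart (hM i) (B i)) (Hu i).
Qed.

Lemma prod_is_chart B : is_chart B.
Proof.
have hB i := manifold_chart (hM i) (B i).
split.
- by apply: (@open_box I (fun i => carrier (M i)) (fun i => cdom (B i))) => i; case: (hB i).
- rewrite prod_cimgE openE => u Hu.
  apply: (filter_forall (nbhs_filter u)) => i.
  case: (hB i) => _ oI _ _ _; apply: block_continuous.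
  exact: open_nbhs_nbhs (conj oI (Hu i)).
- move=> x Dx; apply: functional_extensionality_dep => i /=; rewrite block_sum.
  by case: (hB i) => _ _ -> //; exact: Dx.
- move=> x /set_mem Dx; apply: continuous_at_sum => i.
  apply: (@continuous_comp _ _ _ (fun y : prod_space M => cmap (B i) (y i)) (@to_block R I n i)).
    apply: (@continuous_comp _ _ _ (fun y : prod_space M => y i) (cmap (B i))).
      exact: (@proj_continuous I (fun i => carrier (M i)) i).
    by case: (hB i) => _ _ _ cm _; apply: cm; rewrite inE; exact: Dx.
  exact: to_block_continuous.
- move=> u /set_mem; rewrite prod_cimgE => Hu.
  apply: (@continuous_at_prod _ I (fun i => carrier (M i))) => i.
  apply: (@continuous_comp _ _ _ (@block R I n i) (cinv (B i))).
    exact: block_continuous.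
  by case: (hB i) => _ _ _ _ ci; apply: ci; rewrite inE; exact: Hu.
Qed.

Lemma prod_cover (x : prod_space M) : exists B, cdom B x.
Proof.
by have [B HB] := choice_dep (fun i => manifold_cover (hM i) (x i)); exists B.
Qed.

End products.

Section submanifold_charts.
Variables (R : realType) (I : finType) (n : I -> nat).
Variables (M : forall i, charted_space R (n i)).
Hypothesis hM : forall i, is_manifold (M i).
Variables (d : nat) (A : set (prod_space M)).
Implicit Types (c : chart_idx (submanifold A d)) (B : chart_idx (prod_space M)).
Implicit Types (x : submanifold A d).

(** The inclusion of A into the product, read in charts; [factor_rep] is likewise the projection of
    A to one factor. *)
Definition prod_rep c B : 'rV[R]_d -> 'rV[R]_(pdim n) :=
  cmap B \o set_val \o cinv c.

Definition prod_rep_dom c B : set 'rV[R]_d :=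
  cmap c @` (cdom c `&` [set x | cdom B (set_val x)]).

Definition factor_rep c i (b : chart_idx (M i)) : 'rV[R]_d -> 'rV[R]_(n i) :=
  fun z => cmap b (set_val (cinv c z) i).

Definition factor_rep_dom c i (b : chart_idx (M i)) : set 'rV[R]_d :=
  cmap c @` (cdom c `&` [set x | cdom b (set_val x i)]).

Lemma submanifold_chartP c : is_submanifold_chart (projT1 c).
Proof. by case: c. Qed.

Lemma submanifold_is_chart c : is_chart c.
Proof. by case: c => c []. Qed.

Lemma cmapK c x : cdom c x -> cinv c (cmap c x) = x.
Proof. by case: (submanifold_is_chart c) => _ _ K _ _; exact: K. Qed.

Lemma factor_continuous i : continuous (fun x => set_val x i : M i).
Proof.
move=> x; apply: (@continuous_comp _ _ _ (set_val : submanifold A d -> prod_space M)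
  (fun y : prod_space M => y i)).
  exact: set_val_continuous.
exact: (@proj_continuous I (fun i => carrier (M i)) i).
Qed.

Lemma prod_rep_dom_open c B : open (prod_rep_dom c B).
Proof.
apply: chart_image_open; first exact: submanifold_is_chart.
by apply: open_set_val; case: (prod_is_chart hM B).
Qed.

Lemma factor_dom_open i (b : chart_idx (M i)) :
  open [set x : submanifold A d | cdom b (set_val x i)].
Proof.
apply: (@open_comp _ _ (fun x : submanifold A d => set_val x i : M i)).
  by move=> x _; exact: factor_continuous.
by case: (manifold_chart (hM i) b).
Qed.

Lemma factor_rep_dom_open c i (b : chart_idx (M i)) : open (factor_rep_dom c b).
Proof.
apply: chart_image_open; first exact: submanifold_is_chart.
exact: factor_dom_open.
Qed.

Lemma prod_rep_smooth c B : smooth_on (prod_rep_dom c B) (prod_rep c B).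
Proof. by have [_ /(_ B) []] := submanifold_chartP c. Qed.

Lemma prod_rep_inj c B x v : cdom c x -> cdom B (set_val x) ->
  'D_v (prod_rep c B) (cmap c x) = 0 -> v = 0.
Proof.
move=> cx Bx; have [_ /(_ B) [_ H]] := submanifold_chartP c.
by apply: H; split.
Qed.

Lemma prod_rep_at c B x : cdom c x -> prod_rep c B (cmap c x) = cmap B (set_val x).
Proof. by move=> cx; rewrite /prod_rep /= cmapK. Qed.

Lemma factor_rep_at c i (b : chart_idx (M i)) x :
  cdom c x -> factor_rep c b (cmap c x) = cmap b (set_val x i).
Proof. by move=> cx; rewrite /factor_rep cmapK. Qed.

Lemma block_prod_rep c B i z : block i (prod_rep c B z) = factor_rep c (B i) z.
Proof. by rewrite /prod_rep /= block_sum. Qed.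

Lemma prod_rep_diff c B x : cdom c x -> cdom B (set_val x) ->
  differentiable (prod_rep c B) (cmap c x).
Proof. by move=> cx Bx; apply: smooth_on_diff (prod_rep_smooth c B) _; exists x. Qed.

Lemma factor_rep_derive c B i x v : cdom c x -> cdom B (set_val x) ->
  'D_v (factor_rep c (B i)) (cmap c x) = block i ('D_v (prod_rep c B) (cmap c x)).
Proof.
move=> cx Bx; rewrite blockE.
have -> : factor_rep c (B i) = (fun z => prod_rep c B z *m block_mx_proj R n i).
  by apply/funext => z; rewrite -blockE block_prod_rep.
by have [_ ->] := derive_mulmx (block_mx_proj R n i) v (prod_rep_diff cx Bx).
Qed.

Lemma prod_cover_with i (b : chart_idx (M i)) (y : prod_space M) :
  cdom b (y i) -> exists2 B : chart_idx (prod_space M), cdom B y & B i = b.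
Proof.
move=> by_; have [B0 HB0] := prod_cover hM y.
exists (@dfwith I (fun i => chart_idx (M i)) B0 i b); last by rewrite dfwithin.
by move=> j /=; case: dfwithP => [//|k _]; exact: HB0.
Qed.

Lemma factor_rep_smooth c i (b : chart_idx (M i)) :
  smooth_on (factor_rep_dom c b) (factor_rep c b).
Proof.
apply: smooth_on_local => _ [x [cx bx] <-].
have [B Bx Bi] := prod_cover_with bx; subst b.
exists (prod_rep_dom c B); first by exists x.
apply: (smooth_on_eq (f := fun z => prod_rep c B z *m block_mx_proj R n i)).
- exact: prod_rep_dom_open.
- by move=> z _; rewrite -blockE block_prod_rep.
- by apply: smooth_on_mulmx; [exact: prod_rep_dom_open|exact: prod_rep_smooth].
Qed.

Lemma factor_rep_diff c i (b : chart_idx (M i)) x :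
  cdom c x -> cdom b (set_val x i) -> differentiable (factor_rep c b) (cmap c x).
Proof. by move=> cx bx; apply: smooth_on_diff (factor_rep_smooth c b) _; exists x. Qed.

Lemma factor_rep_change c i (b b' : chart_idx (M i)) x v :
  cdom c x -> cdom b (set_val x i) -> cdom b' (set_val x i) ->
  'D_v (factor_rep c b') (cmap c x) =
  'D_('D_v (factor_rep c b) (cmap c x)) (cmap b' \o cinv b) (cmap b (set_val x i)).
Proof.
move=> cx bx b'x; rewrite -(factor_rep_at b cx) -derive_comp; last 2 first.
- exact: factor_rep_diff.
- rewrite factor_rep_at //.
  by apply: smooth_on_diff (manifold_transition (hM i) b b') _; exists (set_val x i).
have xd : factor_rep_dom c b (cmap c x) by exists x.
have E : \forall z \near cmap c x,
    factor_rep c b' z = ((cmap b' \o cinv b) \o factor_rep c b) z.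
  have oU : open (factor_rep_dom c b) by exact: factor_rep_dom_open.
  apply: near_open_set oU xd _.
  move=> _ [y [cy by_] <-] /=; rewrite !factor_rep_at //.
  by case: (manifold_chart (hM i) b) => _ _ -> //.
exact: near_eq_derive E.
Qed.

(** The submanifold coordinates are smooth functions s of the ambient ones. Smoothness of transition
    maps and of lifted fields is deduced from this. *)
Lemma local_retraction c B x : cdom c x -> cdom B (set_val x) ->
  exists (O : set 'rV[R]_d) (W : set 'rV[R]_(pdim n)) s,
    [/\ open O, O (cmap c x) & O `<=` prod_rep_dom c B] /\
    [/\ open W, smooth_on W s &
        forall y, O y -> W (prod_rep c B y) /\ s (prod_rep c B y) = y].
Proof.
move=> cx Bx; apply: local_left_inverse.
- exact: prod_rep_dom_open.
- by exists x.
- exact: prod_rep_smooth.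
- by move=> v; exact: prod_rep_inj.
Qed.

Lemma submanifold_transition c c' :
  smooth_on (cmap c @` (cdom c `&` cdom c')) (cmap c' \o cinv c).
Proof.
apply: smooth_on_local => _ [x [cx c'x] <-].
have [B Bx] := prod_cover hM (set_val x).
have [N [W [s [[oN Nx NB] [oW ss Hs]]]]] := local_retraction c'x Bx.
pose G := (cdom c' `&` cmap c' @^-1` N) `&` [set y | cdom B (set_val y)].
have oG : open G.
  apply: openI; first by apply: chart_preimage_open => //; exact: submanifold_is_chart.
  by apply: open_set_val; case: (prod_is_chart hM B).
have oU : open (cmap c @` (cdom c `&` G)).
  by apply: chart_image_open => //; exact: submanifold_is_chart.
exists (cmap c @` (cdom c `&` G)); first by exists x.
have E y : cdom c y -> cdom c' y ->
    prod_rep c' B (cmap c' y) = prod_rep c B (cmap c y).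
  by move=> cy c'y; rewrite !prod_rep_at.
apply: (smooth_on_eq (f := s \o prod_rep c B) oU).
  move=> _ [y [cy [[c'y Ny] By]] <-] /=.
  by rewrite -E // cmapK //; have [_ ->] := Hs _ Ny.
apply: (smooth_on_comp oU oW) => //.
  by move=> _ [y [cy [[c'y Ny] By]] <-]; rewrite -E //; have [] := Hs _ Ny.
apply: smooth_on_subset (prod_rep_smooth c B) => _ [y [cy [_ By]] <-].
by exists y.
Qed.

(** Submanifold charts are automatically compatible, and the topological conditions are inherited
    from the product; only the existence of enough charts remains. *)
Lemma submanifold_is_manifold :
  (forall x, exists c, cdom c x) -> is_manifold (submanifold A d).
Proof.
move=> cov; split=> //.
- apply: hausdorff_set_type.
  by apply: (@hausdorff_product I (fun i => carrier (M i))) => i; case: (hM i).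
- apply: second_countable_set_type.
  by apply: (@second_countable_prod I (fun i => carrier (M i))) => i; case: (hM i).
- exact: submanifold_is_chart.
- exact: submanifold_transition.
Qed.

End submanifold_charts.

(** * The diagonal manifold *)

(** The differences phi i - phi j satisfy the obvious relations themselves. After renaming summation
    indices, the coefficient of [r i l j] is (phi i - phi j) - (phi i - phi l) - (phi l - phi j) =
    0. *)
Lemma obvious_relations_vanish (R : comNzRingType) (I : finType) (A : {set I})
    (r : I -> I -> I -> R) (phi : I -> R) :
  \sum_(i in A) \sum_(j in A)
    (\sum_(l in A) (r i l j - r i j l - r l i j)) * (phi i - phi j) = 0.
Proof.
pose T (g : I -> I -> I -> R) := \sum_(i in A) \sum_(j in A) \sum_(l in A) g i j l.
have TB g h : T (fun i j l => g i j l - h i j l) = T g - T h.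
  rewrite /T -sumrB; apply: eq_bigr => i _; rewrite -sumrB; apply: eq_bigr => j _.
  by rewrite -sumrB.
transitivity (T (fun i j l => r i l j * (phi i - phi j) - r i j l * (phi i - phi j)
   - r l i j * (phi i - phi j))).
  apply: eq_bigr => i _; apply: eq_bigr => j _; rewrite mulr_suml.
  by apply: eq_bigr => l _; rewrite !mulrBl.
have E2 : T (fun i j l => r i j l * (phi i - phi j)) =
    T (fun i j l => r i l j * (phi i - phi l)).
  by apply: eq_bigr => i _; rewrite exchange_big.
have E3 : T (fun i j l => r l i j * (phi i - phi j)) =
    T (fun i j l => r i l j * (phi l - phi j)).
  rewrite /T (eq_bigr (fun i => \sum_(l in A) \sum_(j in A) r l i j * (phi i - phi j))).
    rewrite exchange_big /=; apply: eq_bigr => i _; rewrite exchange_big.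
    by apply: eq_bigr => j _.
  by move=> i _; rewrite exchange_big.
rewrite !TB E2 E3 -!TB /T big1 // => i _; rewrite big1 // => j _.
by rewrite big1 // => l _; rewrite -!mulrBr; ring.
Qed.

Section diagonal.
Variables (R : realType) (I K : finType) (n : I -> nat).
Variables (M : forall i, charted_space R (n i)).
Variables (S : K -> {set I}) (f : forall i, K -> M i -> R) (ref : K -> I).
Arguments f {i}.
Hypothesis hM : forall i, is_manifold (M i).
Hypothesis refP : forall k, ref k \in S k.
Hypothesis hf : forall i k, i \in S k -> smooth_fun (f (i := i) k).
Hypothesis hind : forall x : prod_space M,
  diagonal_subset S (fun i => f (i := i)) x ->
  independent_up_to_obvious S (fun i => f (i := i)) x.
Implicit Types (B : chart_idx (prod_space M)).

Let f' := fun i => f (i := i).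

Definition local_integral i (b : chart_idx (M i)) (k : K) : 'rV[R]_(n i) -> R^o :=
  f k \o cinv b.

Lemma local_integral_diff i (b : chart_idx (M i)) k y : i \in S k -> cdom b y ->
  differentiable (local_integral b k) (cmap b y).
Proof. by move=> iS by_; apply: smooth_on_diff (hf iS b) _; exists y. Qed.

Lemma local_integral_block_smooth B i k : i \in S k ->
  smooth_on (cimg B) (fun u => local_integral (B i) k (block i u) : R^o).
Proof.
move=> iS; have oB : open (cimg B) by case: (prod_is_chart hM B).
apply: (smooth_on_comp_R (f := @block R I n i) oB _ _ (hf iS (B i))).
  by rewrite (prod_cimgE hM) => u; exact.
apply: (smooth_on_eq (f := mulmxr (block_mx_proj R n i)) oB).
  by move=> u _; rewrite blockE.
exact: smooth_on_mulmxr.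
Qed.

Lemma local_integral_block_derive B i k (y : prod_space M) v :
  i \in S k -> cdom B y ->
  'D_v (fun u => local_integral (B i) k (block i u) : R^o) (cmap B y) =
  'D_(block i v) (local_integral (B i) k) (cmap (B i) (y i)).
Proof.
move=> iS By.
have db : differentiable (fun u : 'rV[R]_(pdim n) => u *m block_mx_proj R n i) (cmap B y).
  by have [] := @derive_mulmx R _ _ _ id (block_mx_proj R n i) (cmap B y) 0 (ex_diff).
have Eb : @block R I n i = (fun u => u *m block_mx_proj R n i).
  by apply/funext => u; rewrite blockE.
have bB : block i (cmap B y) = cmap (B i) (y i) by rewrite /= block_sum.
rewrite -bB (@derive_comp _ _ _ _ (@block R I n i) (local_integral (B i) k)).
- congr ('D_ _ _ _); rewrite Eb.
  have [_ ->] := @derive_mulmx R _ _ _ id (block_mx_proj R n i) (cmap B y) v (ex_diff).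
  by rewrite derive_id.
- by rewrite Eb.
- by rewrite bB; apply: local_integral_diff => //; exact: By.
Qed.

Lemma constraint_derive B k i j (y : prod_space M) v :
  i \in S k -> j \in S k -> cdom B y ->
  differentiable (constraint f' k i j \o cinv B : _ -> R^o) (cmap B y) /\
  'D_v (constraint f' k i j \o cinv B : _ -> R^o) (cmap B y) =
  'D_(block i v) (local_integral (B i) k) (cmap (B i) (y i)) -
  'D_(block j v) (local_integral (B j) k) (cmap (B j) (y j)).
Proof.
move=> iS jS By.
have d l : l \in S k ->
    differentiable (fun u => local_integral (B l) k (block l u) : R^o) (cmap B y).
  by move=> lS; apply: smooth_on_diff (local_integral_block_smooth B lS) _; exists y.
rewrite -!local_integral_block_derive // -deriveB; last 2 first.
- exact/diff_derivable/d.
- exact/diff_derivable/d.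
by split=> //; apply: differentiableB; exact: d.
Qed.

Definition free_constraints : {set K * I} :=
  [set ki | (ki.2 \in S ki.1) && (ki.2 != ref ki.1)].

Definition equations B (u : 'rV[R]_(pdim n)) : 'rV[R]_#|free_constraints| :=
  \row_a constraint f' (enum_val a).1 (ref (enum_val a).1) (enum_val a).2 (cinv B u).

Lemma free_constraintP (a : 'I_#|free_constraints|) :
  ((enum_val a).2 \in S (enum_val a).1) /\ ((enum_val a).2 != ref (enum_val a).1).
Proof. by have := enum_valP a; rewrite inE => /andP. Qed.

Lemma equations_smooth B : smooth_on (cimg B) (equations B).
Proof.
have oB : open (cimg B) by case: (prod_is_chart hM B).
apply: smooth_on_rV => // a k.
set ki := enum_val a.
have kiS : ki.2 \in S ki.1 by have [] := free_constraintP a.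
apply: (Ck_on_eq oB (f := (fun u => local_integral (B (ref ki.1)) ki.1 (block (ref ki.1) u) : R^o)
   \+ (fun u => - (local_integral (B ki.2) ki.1 (block ki.2 u) : R^o)))).
  by move=> u _; rewrite mxE.
apply: Ck_onD => //; first exact: local_integral_block_smooth.
by apply: Ck_onN => //; exact: local_integral_block_smooth.
Qed.

Lemma equations0 B (u : 'rV[R]_(pdim n)) :
  equations B u = 0 <-> diagonal_subset S f' (cinv B u).
Proof.
split=> [E|D]; last first.
  apply/rowP => a; rewrite !mxE; have [aS _] := free_constraintP a.
  by rewrite /constraint (D _ _ _ (refP _) aS) subrr.
suff H i k : i \in S k -> f k (cinv B u (ref k)) = f k (cinv B u i).
  by move=> i j k iS jS; rewrite /f' -(H i) // -(H j).
move=> iS; have [->//|ik] := eqVneq i (ref k).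
have kC : (k, i) \in free_constraints by rewrite inE /= iS.
have := congr1 (fun v : 'rV[R]_#|free_constraints| => v 0 (enum_rank_in kC (k, i))) E.
by rewrite !mxE enum_rankK_in //= /constraint => /eqP; rewrite subr_eq0 => /eqP.
Qed.

(** A relation among the chosen equations, extended by zero to all pairs (i, j), is a combination of
    obvious relations by [hind]; pairing it with an indicator function then shows that each
    coefficient vanishes. *)
Lemma free_constraints_indep B (y : prod_space M) (c : 'I_#|free_constraints| -> R) :
  diagonal_subset S f' y -> cdom B y ->
  \sum_a c a *: dF B (constraint f' (enum_val a).1 (ref (enum_val a).1) (enum_val a).2) y = 0 ->
  forall a, c a = 0.
Proof.
move=> Dy By c0.
pose G (ki : K * I) := dF B (constraint f' ki.1 (ref ki.1) ki.2) y.
(* The sum has at most one term: this is extension by zero outside [free_constraints]. *)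
pose cc (ki : K * I) := \sum_(a | enum_val a == ki) c a.
have ccE a : cc (enum_val a) = c a.
  by rewrite /cc (big_pred1 a) // => b; rewrite (inj_eq enum_val_inj).
have cc0 ki : ki \notin free_constraints -> cc ki = 0.
  move=> kiC; rewrite /cc big_pred0 // => a; apply/negP => /eqP ak.
  by rewrite -ak enum_valP in kiC.
pose c' k i j := if i == ref k then cc (k, j) else 0.
have E : \sum_k \sum_(i in S k) \sum_(j in S k) c' k i j *: dF B (constraint f' k i j) y = 0.
  rewrite -[RHS]c0 (eq_bigr (fun a => cc (enum_val a) *: G (enum_val a))); last first.
    by move=> a _; rewrite ccE.
  rewrite -(big_enum_val (fun ki => cc ki *: G ki)) /=.
  transitivity (\sum_k \sum_(j in S k) cc (k, j) *: G (k, j)).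
    apply: eq_bigr => k _; rewrite (bigD1 (ref k)) //= [X in _ + X]big1 ?addr0.
      by apply: eq_bigr => j _; rewrite /c' eqxx.
    move=> i /andP[_ ik]; rewrite big1 // => j _.
    by rewrite /c' (negPf ik) scale0r.
  rewrite pair_big_dep /= (bigID (mem free_constraints)) /= addrC big1 ?add0r.
    apply: eq_big => [[k j]|[k j] _] //=; rewrite andbC inE /=.
    by case: (j \in S k); rewrite ?andbT ?andbF.
  by move=> [k j] /andP[_ /cc0]/= ->; rewrite scale0r.
have [r Hr] := hind Dy By E.
move=> a; have [aS ar] := free_constraintP a; rewrite -ccE.
set k := (enum_val a).1 in aS ar *; set j1 := (enum_val a).2 in aS ar *.
have -> : enum_val a = (k, j1) by rewrite /k /j1; case: (enum_val a).
(* The coefficients [c' k i j] live on i = ref k, and j1 differs from ref k, so only the pair (ref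
   k, j1) contributes, with factor -1. *)
have := obvious_relations_vanish (S k) (r k) (fun i => (i == j1)%:R).
rewrite (eq_bigr (fun i => \sum_(j in S k) c' k i j * ((i == j1)%:R - (j == j1)%:R))); last first.
  by move=> i iS; apply: eq_bigr => j jS; rewrite Hr.
rewrite (bigD1 (ref k)) //= [X in _ + X]big1 ?addr0; last first.
  by move=> i /andP[_ ik]; rewrite big1 // => j _; rewrite /c' (negPf ik) mul0r.
rewrite (bigD1 j1) //= big1 ?addr0; last first.
  move=> j /andP[_ jj]; rewrite (negPf jj) [ref k == j1]eq_sym (negPf ar).
  by rewrite subrr mulr0.
rewrite /c' !eqxx [ref k == j1]eq_sym (negPf ar) sub0r mulrN mulr1.
by move/eqP; rewrite oppr_eq0 => /eqP.
Qed.

Definition equations_matrix B (y : prod_space M) : 'M[R]_(#|free_constraints|, pdim n) :=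
  \matrix_a dF B (constraint f' (enum_val a).1 (ref (enum_val a).1) (enum_val a).2) y.

Lemma equations_matrix_free B (y : prod_space M) :
  diagonal_subset S f' y -> cdom B y -> row_free (equations_matrix B y).
Proof.
move=> Dy By; apply: inj_row_free => c cE; apply/rowP => a; rewrite mxE.
apply: (free_constraints_indep (c := fun a => c 0 a) Dy By).
rewrite -[RHS]cE mulmx_sum_row; apply: eq_bigr => b _.
by congr (_ *: _); apply/rowP => l; rewrite !mxE.
Qed.

Lemma equations_derive B (y : prod_space M) v :
  cdom B y -> 'D_v (equations B) (cmap B y) = v *m (equations_matrix B y)^T.
Proof.
move=> By; apply/rowP => a.
have dE : differentiable (equations B) (cmap B y).
  by apply: smooth_on_diff (equations_smooth B) _; exists y.
rewrite derive_mx; last exact: diff_derivable.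
rewrite mxE; have [aS _] := free_constraintP a.
have [dc _] := constraint_derive v (refP (enum_val a).1) aS By.
have -> : (fun u => equations B u 0 a) =
    constraint f' (enum_val a).1 (ref (enum_val a).1) (enum_val a).2 \o cinv B.
  by apply/funext => u; rewrite mxE.
rewrite derive_rV // mxE; apply: eq_bigr => l _.
by rewrite !mxE.
Qed.

Lemma equations_surj B (y : prod_space M) w :
  diagonal_subset S f' y -> cdom B y -> exists v, 'D_v (equations B) (cmap B y) = w.
Proof.
move=> Dy By; have := equations_matrix_free Dy By.
rewrite /row_free -mxrank_tr -[_ == _]/(row_full _) => /row_fullP[A HA].
by exists (w *m A); rewrite equations_derive // -mulmxA HA mulmx1.
Qed.

End diagonal.

Lemma smooth_on_blocks (R : realType) (V : normedModType R) (I : finType)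
    (n : I -> nat) (U : set V) (h : V -> 'rV[R]_(pdim n)) :
  open U -> (forall i, smooth_on U (fun z => block i (h z))) -> smooth_on U h.
Proof.
move=> oU H; apply: smooth_on_rV => // k.
rewrite -(enum_valK k); case: (enum_val k) => i j.
apply: (smooth_on_eq (f := fun z => block i (h z) 0 j : R^o) oU).
  by move=> z _; rewrite mxE.
exact: smooth_on_coord.
Qed.

Lemma continuous_at_near_eq (T T' : topologicalType) (f g : T -> T') (z : T) :
  (\forall t \near z, f t = g t) ->
  {for z, continuous f} -> {for z, continuous g}.
Proof.
move=> fg cf; rewrite /prop_for /continuous_at -(nbhs_singleton fg).
exact: cvg_trans (near_eq_cvg fg) cf.
Qed.

(** * Charts and tangent spaces of the diagonal *)

Section diagonal_charts.
Variables (R : realType) (I K : finType) (n : I -> nat).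
Variables (M : forall i, charted_space R (n i)).
Variables (S : K -> {set I}) (f : forall i, K -> M i -> R) (ref : K -> I).
Variable d : nat.
Hypothesis hM : forall i, is_manifold (M i).
Hypothesis refP : forall k, ref k \in S k.
Hypothesis hf : forall i k, i \in S k -> smooth_fun (@f i k).
Hypothesis hind : forall x : prod_space M,
  diagonal_subset S f x -> independent_up_to_obvious S f x.
Hypothesis hdim : (#|free_constraints S ref| + d = pdim n)%N.
Implicit Types (B : chart_idx (prod_space M)) (x : diagonal_manifold S f d).

Lemma diagonal_chart_exists x : exists c : chart_idx (diagonal_manifold S f d), cdom c x.
Proof.
have Dval (y : diagonal_manifold S f d) : diagonal_subset S f (set_val y).
  exact: set_mem (valP y).
have [B Bx] := prod_cover hM (set_val x).
have [oDB oB BK cB ciB] := prod_is_chart hM B.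
have u0 : cimg B (cmap B (set_val x)) by exists (set_val x).
have sE : smooth_on (cimg B) (equations S f ref B) by exact: equations_smooth.
have e0 u : equations S f ref B u = 0 <-> diagonal_subset S f (cinv B u).
  exact: equations0.
have [|P [Q [Z [psi [[oQ Qx QB] [oZ spsi Hu Hz]]]]]] :=
    level_set_parametrization hdim oB u0 sE.
  by move=> w; exact: equations_surj.
(* For z in Z the point [cinv B (psi z)] satisfies the equations; elsewhere x serves as a default
   value. *)
pose inv z : diagonal_manifold S f d :=
  if pselect (diagonal_subset S f (cinv B (psi z))) is left p
  then exist _ (cinv B (psi z)) (mem_set p) else x.
pose c : chart R (diagonal_manifold S f d) d :=
  Chart [set y | cdom B (set_val y) /\ Q (cmap B (set_val y))]
    (fun y => cmap B (set_val y) *m P) inv.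
have ZP z : Z z -> [/\ set_val (inv z) = cinv B (psi z), cdom c (inv z) & cmap c (inv z) = z].
  move=> Zz; have [Qz gz zP] := Hz z Zz.
  have Dz : diagonal_subset S f (cinv B (psi z)) by exact: (e0 _).1 gz.
  have E : set_val (inv z) = cinv B (psi z) by rewrite /inv; case: pselect.
  have [D1 D2] := chart_cinvK (prod_is_chart hM B) (QB _ Qz).
  split=> //.
    by rewrite -[cdom c _]/(cdom B (set_val (inv z)) /\ Q (cmap B (set_val (inv z)))) E D2.
  by rewrite -[cmap c _]/(cmap B (set_val (inv z)) *m P) E D2.
have dP y : cdom c y -> Z (cmap c y) /\ psi (cmap c y) = cmap B (set_val y).
  move=> [By Qy]; apply: Hu => //; apply: (e0 _).2.
  by rewrite BK //; exact: Dval.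
have invK y : cdom c y -> inv (cmap c y) = y.
  move=> cy; have [Zy psiy] := dP y cy; have [E _ _] := ZP _ Zy.
  by apply: val_inj; rewrite -[LHS]/(set_val _) E psiy BK //; case: cy.
have cimgE : cimg c = Z.
  apply/seteqP; split=> [_ [y cy <-]|z Zz]; first by have [] := dP y cy.
  by have [_ cz zE] := ZP z Zz; exists (inv z).
have cmapc y : cdom B (set_val y) ->
    {for y, continuous (fun y : diagonal_manifold S f d => cmap B (set_val y))}.
  move=> By; apply: (@continuous_comp _ _ _ (set_val : diagonal_manifold S f d -> prod_space M)).
    exact: set_val_continuous.
  by apply: cB; rewrite inE.
have hc : is_chart c.
  split.
  - have oS : open [set y : diagonal_manifold S f d | cdom B (set_val y)].
      exact: open_set_val.
    by apply: (open_preimage_in oS _ oQ) => y /set_mem By; exact: cmapc.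
  - by rewrite cimgE.
  - exact: invK.
  - move=> y /set_mem [By _].
    apply: (@continuous_comp _ _ _
      (fun y : diagonal_manifold S f d => cmap B (set_val y)) (mulmxr P)).
      exact: cmapc.
    exact: rV_linear_continuous.
  - move=> z; rewrite cimgE => /set_mem Zz; apply: continuous_at_set_type.
    have cz : {for z, continuous (cinv B \o psi)}.
      apply: continuous_comp; first exact: smooth_on_continuous spsi Zz.
      by apply: ciB; rewrite inE; apply: QB; have [] := Hz z Zz.
    apply: (continuous_at_near_eq _ cz).
    by apply: (near_open_set oZ Zz) => z' /ZP[E _ _]; exact: esym E.
suff hsub : is_submanifold_chart c by exists (exist _ c hsub); split.
split=> // B' U h.
pose G := cmap c @` U.
have oG : open G.
  apply: (chart_image_open hc); apply: open_set_val.
  by case: (prod_is_chart hM B').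
have GZ z : G z -> Z z by move=> [y [cy _] <-]; have [] := dP y cy.
(* The product chart B' is arbitrary; it is compared with B on each factor through the transition
   maps of [M i]. *)
pose V (a b : chart_idx (prod_space M)) i := cmap (a i) @` (cdom (a i) `&` cdom (b i)).
have oV a b i : open (V a b i).
  apply: chart_image_open; first exact: (manifold_chart (hM i)).
  by case: (manifold_chart (hM i) (b i)).
have sV a b i : smooth_on (V a b i) (cmap (b i) \o cinv (a i)).
  exact: (manifold_transition (hM i)).
have psiE i y : cdom c y -> block i (psi (cmap c y)) = cmap (B i) (set_val y i).
  by move=> cy; have [_ ->] := dP y cy; rewrite /= block_sum.
have hE i y : cdom c y -> block i (h (cmap c y)) = cmap (B' i) (set_val y i).
  move=> cy; rewrite -[h _]/(cmap B' (set_val (inv (cmap c y)))) invK //.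
  by rewrite /= block_sum.
have sblock i : smooth_on G (fun z => block i (psi z)).
  apply: (smooth_on_eq (f := fun z => psi z *m block_mx_proj R n i) oG).
    by move=> z _; rewrite blockE.
  by apply: smooth_on_mulmx => //; apply: smooth_on_subset spsi.
have sh i : smooth_on G (fun z => block i (h z)).
  apply: (smooth_on_eq (f := (cmap (B' i) \o cinv (B i)) \o (fun z => block i (psi z))) oG).
    move=> _ [y [cy B'y] <-] /=; rewrite psiE // hE //.
    by case: (manifold_chart (hM i) (B i)) => _ _ -> //; case: cy.
  apply: (smooth_on_comp oG (oV B B' i)) => // _ [y [cy B'y] <-].
  by rewrite psiE //; exists (set_val y i) => //; split; [case: cy|].
split; first exact: smooth_on_blocks.
move=> y v Uy Dh.
have Gz : G (cmap c y) by exists y.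
have dh : differentiable h (cmap c y).
  by apply: smooth_on_diff (smooth_on_blocks oG sh) Gz.
have dpsi : differentiable psi (cmap c y) by apply: smooth_on_diff spsi _; exact: GZ.
(* Locally psi is h followed by the transitions back to B, so its derivative along v vanishes with
   that of h; then psi z P = z forces v = 0. *)
have Dpsi : 'D_v psi (cmap c y) = 0.
  apply: block_inj => i.
  have [_ E1] := derive_mulmx (block_mx_proj R n i) v dpsi.
  have [_ E2] := derive_mulmx (block_mx_proj R n i) v dh.
  rewrite !blockE -E1 mul0mx.
  have Eb : (fun z => h z *m block_mx_proj R n i) = (fun z => block i (h z)).
    by apply/funext => z; rewrite blockE.
  rewrite Dh mul0mx Eb in E2.
  have E3 : \forall z \near cmap c y, psi z *m block_mx_proj R n i =
      ((cmap (B i) \o cinv (B' i)) \o (fun z => block i (h z))) z.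
    apply: near_open_set oG Gz _ => _ [y' [cy' B'y'] <-] /=.
    rewrite -blockE psiE // hE //.
    by case: (manifold_chart (hM i) (B' i)) => _ _ ->.
  have [cy B'y] := Uy.
  rewrite (near_eq_derive _ E3) derive_comp ?E2 ?derive0 //.
    exact: smooth_on_diff (sh i) Gz.
  apply: smooth_on_diff (sV B' B i) _; rewrite hE //.
  by exists (set_val y i) => //; split; [exact: B'y|case: cy].
have E : \forall z \near cmap c y, psi z *m P = z.
  by apply: near_open_set oZ (GZ _ Gz) _ => z /Hz[].
have [_] := derive_mulmx P v dpsi.
by rewrite (near_eq_derive _ E) derive_id Dpsi mul0mx.
Qed.

Lemma diagonal_is_manifold : is_manifold (diagonal_manifold S f d).
Proof. by apply: submanifold_is_manifold => // x; exact: diagonal_chart_exists. Qed.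

(* By a dimension count, the tangent space of the diagonal is the whole kernel
   of the differentials of the constraints. *)
Lemma diagonal_tangent (c : chart_idx (diagonal_manifold S f d)) B x v :
  cdom c x -> cdom B (set_val x) ->
  (forall k i j, i \in S k -> j \in S k ->
     'D_(block i v) (local_integral f (B i) k) (cmap (B i) (set_val x i)) =
     'D_(block j v) (local_integral f (B j) k) (cmap (B j) (set_val x j))) ->
  exists w, 'D_w (prod_rep c B) (cmap c x) = v.
Proof.
move=> cx Bx Hv.
have Dx : diagonal_subset S f (set_val x) by exact: set_mem (valP x).
pose J := jacobian (prod_rep c B) (cmap c x).
have sE : smooth_on (cimg B) (equations S f ref B) by exact: equations_smooth.
have e0 u : equations S f ref B u = 0 <-> diagonal_subset S f (cinv B u).
  exact: equations0.
have dr := prod_rep_diff cx Bx.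
have JE w : 'D_w (prod_rep c B) (cmap c x) = w *m J by exact: deriveEjacobian.
have fJ : row_free J.
  by apply: inj_row_free => w; rewrite -JE => /prod_rep_inj; apply.
pose E := equations_matrix S f ref B (set_val x).
have fE : row_free E by exact: equations_matrix_free.
have DE w : 'D_w (equations S f ref B) (cmap B (set_val x)) = w *m E^T.
  exact: equations_derive.
(* The equations vanish identically on the diagonal, so their differential kills the image of the
   inclusion. *)
have JK : (J <= kermx E^T)%MS.
  apply/row_subP => l; apply/sub_kermxP; rewrite rowE -JE -DE.
  rewrite -(prod_rep_at B cx) -derive_comp //; last first.
    rewrite prod_rep_at //; apply: smooth_on_diff sE _.
    by exists (set_val x).
  rewrite -(derive_cst (0 : 'rV[R]_#|free_constraints S ref|) (cmap c x) (delta_mx 0 l)).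
  apply: near_eq_derive.
  have xd : prod_rep_dom c B (cmap c x) by exists x.
  have oU : open (prod_rep_dom c B) by exact: prod_rep_dom_open.
  apply: near_open_set oU xd _ => _ [y [cy By] <-].
  rewrite -[LHS]/(equations S f ref B (prod_rep c B (cmap c y))) prod_rep_at //.
  apply: (e0 _).2.
  by case: (prod_is_chart hM B) => _ _ -> // _ _; exact: set_mem (valP y).
(* Both spaces have dimension d: the rows of J are independent, and so are the [pdim n - d] rows of
   E. *)
have KJ : (kermx E^T <= J)%MS.
  rewrite -(mxrank_leqif_sup JK) mxrank_ker mxrank_tr.
  by rewrite (eqP fJ) (eqP fE) -hdim addnC addnK.
have vK : (v <= kermx E^T)%MS.
  apply/sub_kermxP; rewrite -DE; apply/rowP => a.
  have [aS _] := free_constraintP a.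
  have [_ DC] := constraint_derive hM hf v (refP (enum_val a).1) aS Bx.
  rewrite mxE derive_mx; last first.
    apply/diff_derivable/(smooth_on_diff sE).
    by exists (set_val x).
  rewrite mxE.
  have -> : (fun u => equations S f ref B u 0 a) =
      constraint f (enum_val a).1 (ref (enum_val a).1) (enum_val a).2 \o cinv B.
    by apply/funext => u; rewrite mxE.
  by rewrite DC (Hv _ _ _ (refP _) aS) subrr.
have /submxP[w ->] := submx_trans vK KJ.
by exists w; rewrite JE.
Qed.

End diagonal_charts.

(** * The lifted system *)

Section lifted_system.
Variables (R : realType) (I K : finType) (n p : I -> nat).
Variables (M : forall i, charted_space R (n i)).
Variables (S : K -> {set I}) (f : forall i, K -> M i -> R).
Variable X : forall i, 'I_(p i) -> vfield (M i).
Variables (ref : K -> I) (d : nat).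
Hypothesis hM : forall i, is_manifold (M i).
Hypothesis refP : forall k, ref k \in S k.
Hypothesis hsys : forall i,
  integrable_system (p i) #|K_of S i| (@X i) (integrals_of S f i).
Hypothesis hind : forall x : prod_space M,
  diagonal_subset S f x -> independent_up_to_obvious S f x.
Hypothesis hdim : (#|free_constraints S ref| + d = pdim n)%N.
Local Notation D := (diagonal_manifold S f d).
Local Notation J := {i : I & 'I_(p i)}.
Implicit Types (B : chart_idx (prod_space M)) (x : D) (c : chart_idx D) (t : J).

Lemma factor_integrals_smooth i k : i \in S k -> smooth_fun (@f i k).
Proof.
move=> iS; have /(_ (exist _ k iS)) := integrable_funs (hsys i); exact.
Qed.
Let hf := factor_integrals_smooth.

Definition hlift t : vfield (prod_space M) := horizontal_lift (X (tagged t)).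

Lemma block_hlift i j B y : block i (hlift (Tagged (fun i => 'I_(p i)) j) B y) =
  X j (B i) (y i) :> 'rV[R]_(n i).
Proof. exact: block_to_block. Qed.

Lemma block_hlift_neq i t B y : i != tag t -> block i (hlift t B y) = 0.
Proof. exact: block_to_block_neq. Qed.

Lemma hlift_integral t k i B (y : prod_space M) : i \in S k -> cdom B y ->
  'D_(block i (hlift t B y)) (local_integral f (B i) k) (cmap (B i) (y i)) = 0.
Proof.
move=> iS By; have [E|ne] := eqVneq i (tag t); last first.
  by rewrite block_hlift_neq // derive0.
case: t E => i' j /= E; subst i'; rewrite block_hlift.
have := integrable_first_integral (hsys i) j (exist _ k iS) (By i).
exact.
Qed.

(** A vector representing the lift in one product chart represents it in all of them, which gives
    the choice in [lifted_field] its existence. *)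
Lemma hlift_change t c B B' x w : cdom c x -> cdom B (set_val x) ->
  cdom B' (set_val x) ->
  'D_w (prod_rep c B) (cmap c x) = hlift t B (set_val x) ->
  'D_w (prod_rep c B') (cmap c x) = hlift t B' (set_val x).
Proof.
move=> cx Bx B'x E; apply: block_inj => i.
rewrite -(factor_rep_derive i w cx B'x) (factor_rep_change hM w cx (Bx i) (B'x i)).
rewrite (factor_rep_derive i w cx Bx) E.
have [Ei|ne] := eqVneq i (tag t); last first.
  by rewrite !block_hlift_neq // derive0.
case: t Ei {E} => i' j /= Ei; subst i'; rewrite !block_hlift.
have [H _] := integrable_vfields (hsys i) j.
by rewrite -(H (B i) (B' i) (set_val x i)).
Qed.

(** Quantifying over all B avoids selecting a product chart at each point. The default 0 can occur
    only outside [cdom c]. *)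
Definition lifted_field t : vfield D := fun c x =>
  xget 0 [set w | forall B, cdom B (set_val x) ->
    'D_w (prod_rep c B) (cmap c x) = hlift t B (set_val x)].

Lemma lifted_fieldP t c x B : cdom c x -> cdom B (set_val x) ->
  'D_(lifted_field t c x) (prod_rep c B) (cmap c x) = hlift t B (set_val x).
Proof.
move=> cx Bx; apply: (@xgetPex _ 0 [set w | forall B, cdom B (set_val x) ->
    'D_w (prod_rep c B) (cmap c x) = hlift t B (set_val x)]) => //.
have [w Hw] : exists w, 'D_w (prod_rep c B) (cmap c x) = hlift t B (set_val x).
  apply: (diagonal_tangent hM refP hf hind hdim cx Bx) => k i j iS jS.
  by rewrite !hlift_integral.
by exists w => B' B'x; exact: hlift_change Hw.
Qed.

Lemma prod_rep_derive_inj c B x w w' : cdom c x -> cdom B (set_val x) ->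
  'D_w (prod_rep c B) (cmap c x) = 'D_w' (prod_rep c B) (cmap c x) -> w = w'.
Proof.
move=> cx Bx; have dr := prod_rep_diff cx Bx.
rewrite !deriveE // => /eqP; rewrite -subr_eq0 -linearB -deriveE // => /eqP.
by move=> /(prod_rep_inj cx Bx)/eqP; rewrite subr_eq0 => /eqP.
Qed.

Lemma lifted_field_related t :
  vfield_related (set_val : D -> prod_space M) (lifted_field t) (hlift t).
Proof. by move=> c B x cx Bx; exact: lifted_fieldP. Qed.

Lemma lifted_field_factor t c x B i : cdom c x -> cdom B (set_val x) ->
  'D_(lifted_field t c x) (factor_rep c (B i)) (cmap c x) =
  block i (hlift t B (set_val x)).
Proof. by move=> cx Bx; rewrite factor_rep_derive // lifted_fieldP. Qed.

Lemma lifted_field_change t c c' x : cdom c x -> cdom c' x ->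
  lifted_field t c' x =
  'D_(lifted_field t c x) (cmap c' \o cinv c) (cmap c x).
Proof.
move=> cx c'x; have [B Bx] := prod_cover hM (set_val x).
have dcc : differentiable (cmap c' \o cinv c) (cmap c x).
  by apply: smooth_on_diff (submanifold_transition hM c c') _; exists x.
have E : (cmap c' \o cinv c) (cmap c x) = cmap c' x by rewrite /= cmapK.
apply: (prod_rep_derive_inj c'x Bx); rewrite lifted_fieldP // -E -derive_comp //.
  rewrite -(lifted_fieldP t cx Bx).
  pose G := cdom c' `&` [set y : D | cdom B (set_val y)].
  have oU : open (cmap c @` (cdom c `&` G)).
    apply: chart_image_open; first exact: submanifold_is_chart.
    apply: openI; first by case: (submanifold_is_chart c').
    by apply: open_set_val; case: (prod_is_chart hM B).
  have Ux : (cmap c @` (cdom c `&` G)) (cmap c x) by exists x.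
  apply: near_eq_derive; apply: (near_open_set oU Ux) => _ [y [cy [c'y By]] <-].
  by rewrite /= cmapK // prod_rep_at // prod_rep_at.
by rewrite E; exact: prod_rep_diff.
Qed.

Lemma factor_field_smooth i (j : 'I_(p i)) c B :
  smooth_on (prod_rep_dom c B) (fun z => X j (B i) (set_val (cinv c z) i)).
Proof.
have oU : open (prod_rep_dom c B) by exact: prod_rep_dom_open.
have [_ oI BK _ _] := manifold_chart (hM i) (B i).
have [_ sX] := integrable_vfields (hsys i) j.
apply: (smooth_on_eq (f := (X j (B i) \o cinv (B i)) \o factor_rep c (B i)) oU).
  move=> _ [y [cy By] <-] /=; rewrite factor_rep_at // BK ?cmapK //; exact: By.
apply: (smooth_on_comp oU oI _ _ (sX (B i))).
  by move=> _ [y [cy By] <-]; rewrite factor_rep_at //; exists (set_val y i) => //; exact: By.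
have sr : smooth_on (factor_rep_dom c (B i)) (factor_rep c (B i)).
  exact: factor_rep_smooth.
apply: smooth_on_subset sr => _ [y [cy By] <-].
by exists y => //; split=> //; exact: By.
Qed.

Lemma lifted_field_smooth t : smooth_vfield (lifted_field t).
Proof.
split=> [c c' x|c]; first exact: lifted_field_change.
apply: smooth_on_local => _ [x cx <-].
have [B Bx] := prod_cover hM (set_val x).
have [N [W [s [[oN Nx NB] [oW ss Hs]]]]] := local_retraction hM cx Bx.
exists N => //.
pose lf z : 'rV[R]_(pdim n) := hlift t B (set_val (cinv c z)).
have slf : smooth_on N lf.
  apply: (smooth_on_subset NB).
  have oU : open (prod_rep_dom c B) by exact: prod_rep_dom_open.
  apply: (smooth_on_eq (f := fun z => X (tagged t) (B (tag t)) (set_val (cinv c z) (tag t))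
    *m (block_mx_proj R n (tag t))^T) oU).
    by move=> z _; rewrite -to_blockE.
  by apply: smooth_on_mulmx => //; exact: factor_field_smooth.
(* Since s is a left inverse of the inclusion, its differential takes the ambient lift back to the
   lifted field. *)
apply: (smooth_on_eq (f := fun z => 'D_(lf z) s (prod_rep c B z)) oN); last first.
  apply: (smooth_on_derive_along oN oW) => //; first by move=> y /Hs[].
  exact: smooth_on_subset NB (prod_rep_smooth _ _).
move=> z Nz; have [y [cy By] E] := NB z Nz; subst z.
have [Wz _] := Hs _ Nz.
rewrite /lf /= cmapK // -(lifted_fieldP t cy By) -derive_comp; last 2 first.
- exact: prod_rep_diff.
- exact: smooth_on_diff ss Wz.
rewrite -[RHS](derive_id (cmap c y)); apply: near_eq_derive.
by apply: (near_open_set oN Nz) => z /Hs[].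
Qed.

Lemma integral_factor_rep c i (b : chart_idx (M i)) k z : i \in S k ->
  factor_rep_dom c b z ->
  diagonal_integral S f d k (cinv c z) = local_integral f b k (factor_rep c b z).
Proof.
move=> iS [y [cy by_] <-]; rewrite cmapK // (diagonal_integralE _ iS).
rewrite factor_rep_at // /local_integral /=.
by case: (manifold_chart (hM i) b) => _ _ ->.
Qed.

(** F_k is the integral of any factor i in S_k composed with the projection, so its differential may
    be computed through whichever i is convenient. *)
Lemma integral_derive c B x k i w : i \in S k -> cdom c x -> cdom B (set_val x) ->
  'D_w (diagonal_integral S f d k \o cinv c : _ -> R^o) (cmap c x) =
  'D_('D_w (factor_rep c (B i)) (cmap c x)) (local_integral f (B i) k)
     (cmap (B i) (set_val x i)).
Proof.
move=> iS cx Bx; rewrite -(factor_rep_at (B i) cx) -derive_comp; last 2 first.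
- by apply: factor_rep_diff => //; exact: Bx.
- by rewrite factor_rep_at //; apply: (local_integral_diff hf iS); exact: Bx.
have xd : factor_rep_dom c (B i) (cmap c x) by exists x => //; split=> //; exact: Bx.
have oU : open (factor_rep_dom c (B i)) by exact: factor_rep_dom_open.
apply: near_eq_derive; apply: (near_open_set oU xd) => z Uz.
exact: integral_factor_rep.
Qed.

Lemma diagonal_integral_smooth k : smooth_fun (diagonal_integral S f d k).
Proof.
move=> c; apply: smooth_on_local => _ [x cx <-].
have [b bx] := manifold_cover (hM (ref k)) (set_val x (ref k)).
have oU : open (factor_rep_dom c b) by exact: factor_rep_dom_open.
exists (factor_rep_dom c b); first by exists x.
apply: (smooth_on_eq (f := local_integral f b k \o factor_rep c b) oU).
  by move=> z Uz; rewrite /= (integral_factor_rep (refP k) Uz).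
apply: (smooth_on_comp_R oU _ _ (hf (refP k) b)).
  by move=> _ [y [cy by_] <-]; rewrite factor_rep_at //; exists (set_val y (ref k)).
exact: factor_rep_smooth.
Qed.

Lemma lifted_field_integral t k c x : cdom c x ->
  dF_vfield c (diagonal_integral S f d k) (lifted_field t) x = 0.
Proof.
move=> cx; have [B Bx] := prod_cover hM (set_val x).
rewrite /dF_vfield (integral_derive _ (refP k) cx Bx) lifted_field_factor //.
by rewrite hlift_integral.
Qed.

(* [None] stands for the zero field. *)
Definition factor_component t i : option 'I_(p i) :=
  if tag t =P i is ReflectT e then Some (ecast i 'I_(p i) e (tagged t)) else None.

(** Makes every lift related to a field on [M i], whether or not it comes from this factor, so
    [related_bracket] applies uniformly. *)
Definition component_field i (b : chart_idx (M i)) (o : option 'I_(p i)) :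
    'rV[R]_(n i) -> 'rV[R]_(n i) :=
  fun u => if o is Some j then X j b (cinv b u) else 0.

Lemma block_component t i B (y : prod_space M) : cdom B y ->
  block i (hlift t B y) = component_field (B i) (factor_component t i) (cmap (B i) (y i)).
Proof.
move=> By; rewrite /factor_component; case: eqP => [e|/eqP ne].
  case: i / e; rewrite /component_field /=.
  have [_ _ BK _ _] := manifold_chart (hM (tag t)) (B (tag t)).
  by rewrite BK; [exact: block_to_block|exact: By].
by rewrite block_hlift_neq // eq_sym.
Qed.

Lemma component_field_smooth i (b : chart_idx (M i)) o :
  smooth_on (cimg b) (component_field b o).
Proof.
case: o => [j|]; last by move=> k; exact: Ck_on_cst.
by have [_] := integrable_vfields (hsys i) j; exact.
Qed.

Lemma component_field_commute i (b : chart_idx (M i)) o o' (y : M i) : cdom b y ->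
  'D_(component_field b o (cmap b y)) (component_field b o') (cmap b y) -
  'D_(component_field b o' (cmap b y)) (component_field b o) (cmap b y) = 0.
Proof.
move=> by_; have hb := manifold_chart (hM i) b.
case: o o' => [j|] [j'|]; rewrite /component_field ?derive0
  ?(derive_cst (0 : 'rV[R]_(n i))) ?subrr //.
have := integrable_commute (hsys i) j j' by_; rewrite /lie_bracket.
by case: hb => _ _ -> //.
Qed.

Lemma lifted_field_commute s t c x : cdom c x ->
  lie_bracket (lifted_field s) (lifted_field t) c x = 0.
Proof.
move=> cx; have [B Bx] := prod_cover hM (set_val x).
apply: (prod_rep_inj cx Bx); apply: block_inj => i.
have oU : open (prod_rep_dom c B) by exact: prod_rep_dom_open.
have xd : prod_rep_dom c B (cmap c x) by exists x.
have UI : prod_rep_dom c B `<=` cimg c by move=> _ [y [cy _] <-]; exists y.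
have sl u : smooth_on (prod_rep_dom c B) (lifted_field u c \o cinv c).
  by apply: smooth_on_subset UI _; have [_] := lifted_field_smooth u; exact.
have rel u z : prod_rep_dom c B z ->
    'D_((lifted_field u c \o cinv c) z) (factor_rep c (B i)) z =
    component_field (B i) (factor_component u i) (factor_rep c (B i) z).
  move=> [y [cy By] <-] /=.
  by rewrite cmapK // lifted_field_factor // factor_rep_at // block_component.
have sub : prod_rep_dom c B `<=` factor_rep_dom c (B i).
  by move=> _ [y [cy By] <-]; exists y => //; split=> //; exact: By.
have h1 z : prod_rep_dom c B z -> cimg (B i) (factor_rep c (B i) z).
  move=> [y [cy By] <-]; rewrite factor_rep_at //.
  by exists (set_val y i) => //; exact: By.
have sr : smooth_on (prod_rep_dom c B) (factor_rep c (B i)).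
  by apply: smooth_on_subset sub _; exact: factor_rep_smooth.
have := related_bracket oU xd h1 sr (sl s) (sl t)
  (component_field_smooth (B i) (factor_component s i))
  (component_field_smooth (B i) (factor_component t i)) (rel s) (rel t).
rewrite factor_rep_at // component_field_commute; last exact: Bx.
rewrite -(factor_rep_derive i _ cx Bx) /= cmapK // => E.
by rewrite [LHS]E blockE mul0mx.
Qed.

Definition regular_point x : Prop :=
  forall i, funs_independent_at (integrals_of S f i) (set_val x i).

Lemma integrals_solve i (b : chart_idx (M i)) (y : M i) (t : K -> R) :
  cdom b y -> funs_independent_at (integrals_of S f i) y ->
  exists v, forall k, i \in S k -> 'D_v (local_integral f b k) (cmap b y) = t k.
Proof.
move=> by_ /(_ b by_)/wedge_neq0_solve/(_ (fun l => t (val l)))[v Hv].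
exists v => k iS; rewrite -(Hv (exist _ k iS)) derive_rV.
  by apply: eq_bigr => l _; rewrite mxE.
exact: (local_integral_diff hf iS).
Qed.

(** That t k does not depend on i is exactly the tangency condition, so the vectors v i glue to a
    tangent vector of the diagonal. *)
Lemma regular_tangent c B x (v : forall i, 'rV[R]_(n i)) (t : K -> R) :
  cdom c x -> cdom B (set_val x) ->
  (forall k i, i \in S k ->
     'D_(v i) (local_integral f (B i) k) (cmap (B i) (set_val x i)) = t k) ->
  exists w, forall i, 'D_w (factor_rep c (B i)) (cmap c x) = v i.
Proof.
move=> cx Bx Hv.
have [k i j iS jS|w Hw] := @diagonal_tangent _ _ _ _ _ S f ref d hM refP hf hind hdim
    c B x (\sum_i to_block (v i)) cx Bx; first by rewrite !block_sum !Hv.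
by exists w => i; rewrite factor_rep_derive // Hw block_sum.
Qed.

Lemma regular_integrals_independent x :
  regular_point x -> funs_independent_at (diagonal_integral S f d) x.
Proof.
move=> rx c cx; apply: solve_wedge_neq0 => t.
have [B Bx] := prod_cover hM (set_val x).
have [v Hv] := choice_dep (fun i => integrals_solve t (Bx i) (rx i)).
have [w Hw] := regular_tangent cx Bx (fun k i => Hv i k).
exists w => k.
transitivity ('D_w (diagonal_integral S f d k \o cinv c : _ -> R^o) (cmap c x)).
  rewrite derive_rV; first by apply: eq_bigr => l _; rewrite mxE.
  by apply: smooth_on_diff (diagonal_integral_smooth k c) _; exists x.
by rewrite (integral_derive _ (refP k) cx Bx) Hw Hv.
Qed.

Lemma regular_factor_submersion c i (b : chart_idx (M i)) x w0 :
  regular_point x -> cdom c x -> cdom b (set_val x i) ->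
  exists w, 'D_w (factor_rep c b) (cmap c x) = w0.
Proof.
move=> rx cx bx; have [B Bx Bi] := prod_cover_with hM bx; subst b.
(* The vector w0 dictates the values of the differentials for k in K_i, and the other factors must
   match them; for the remaining k any common value will do. *)
pose t k : R := if i \in S k then
  'D_w0 (local_integral f (B i) k) (cmap (B i) (set_val x i)) else 0.
have [v Hv] := choice_dep (fun j => integrals_solve t (Bx j) (rx j)).
have [k j|w Hw] := @regular_tangent c B x (@dfwith I (fun i => 'rV[R]_(n i)) v i w0) t cx Bx.
  by case: dfwithP => [iS|j' _ jS]; [rewrite /t iS|exact: Hv].
by exists w; rewrite Hw dfwithin.
Qed.

(** Projecting a linear relation to factor i removes the lifts from other factors and leaves a
    relation among the X_{i,j}. *)
Lemma lifted_fields_independent x :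
  (forall i, vfields_independent_at (@X i) (set_val x i)) ->
  vfields_independent_at lifted_field x.
Proof.
move=> Hx c cx; apply: indep_wedge_neq0 => a a0 [i j].
have [B Bx] := prod_cover hM (set_val x).
apply: (solve_indep (c := fun j => a (Tagged (fun i => 'I_(p i)) j))
  (wedge_neq0_solve (Hx i _ (Bx i)))).
have dr : differentiable (factor_rep c (B i)) (cmap c x).
  by apply: factor_rep_diff => //; exact: Bx.
transitivity ('D_(\sum_t a t *: lifted_field t c x) (factor_rep c (B i)) (cmap c x)); last first.
  by rewrite a0 derive0.
rewrite deriveE // linear_sum.
transitivity (\sum_i' \sum_(j' < p i') a (Tagged (fun i => 'I_(p i)) j') *:
   block i (to_block (X j' (B i') (set_val x i')))).
  rewrite (bigD1 i) //= [X in _ + X]big1 ?addr0.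
    by apply: eq_bigr => j' _; rewrite block_to_block.
  by move=> i' ii'; rewrite big1 // => j' _; rewrite block_to_block_neq ?scaler0 // eq_sym.
rewrite (sig_big_dep (fun=> true) (fun i' j' => true) (fun i' j' =>
  a (Tagged (fun i => 'I_(p i)) j') *: block i (to_block (X j' (B i') (set_val x i'))))) /=.
apply: eq_bigr => t _; rewrite linearZ -deriveE //= lifted_field_factor //.
by congr (_ *: _); case: t.
Qed.

Hypothesis hreg : integrals_independent_along_diagonal S f d.

Lemma diagonal_integrals_ae : ae_on (funs_independent_at (diagonal_integral S f d)).
Proof.
move=> c; apply: null_set_subset (hreg c) => _ [x [cx nx] <-].
by exists x => //; split=> // rx; apply: nx; exact: regular_integrals_independent.
Qed.

(** Restricted to regular points, where the projection to [M i] is a submersion and null sets pull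
    back locally to null sets; [null_set_local] makes this global. *)
Lemma factor_fields_ae c i :
  Defs.null_set (cmap c @` [set x | [/\ cdom c x, regular_point x &
    ~ vfields_independent_at (@X i) (set_val x i)]]).
Proof.
apply: null_set_local.
  by case: (diagonal_is_manifold hM refP hf hind hdim).
move=> x [cx rx _]; have [b bx] := manifold_cover (hM i) (set_val x i).
have oU : open (factor_rep_dom c b) by exact: factor_rep_dom_open.
have Ux : factor_rep_dom c b (cmap c x) by exists x.
have sr : smooth_on (factor_rep_dom c b) (factor_rep c b) by exact: factor_rep_smooth.
have [|V [oV Vx VU nV]] :=
    null_preimage_submersion oU Ux sr _ (integrable_vfields_ae (hsys i) b).
  by move=> w0; exact: regular_factor_submersion.
exists (cdom c `&` cmap c @^-1` V); split=> //.
  by apply: chart_preimage_open => //; exact: submanifold_is_chart.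
apply: null_set_subset nV => _ [y [[cy Vy] [_ ry ny]] <-]; split=> //.
have [y' [cy' by'] E] := VU _ Vy.
have yy : y' = y by rewrite -(cmapK cy') E cmapK.
by subst y'; exists (set_val y i) => //; rewrite factor_rep_at.
Qed.

Lemma lifted_fields_ae : ae_on (vfields_independent_at lifted_field).
Proof.
move=> c; apply: null_set_subset (null_setU (hreg c)
  (null_set_bigcup_fin (factor_fields_ae c))) => _ [x [cx nx] <-].
have [rx|nrx] := pselect (regular_point x); last by left; exists x.
right; apply: contra_notP nx => nx; apply: lifted_fields_independent => i.
by apply: contra_notP nx => nxi; exists i, x.
Qed.

End lifted_system.

(** * Dimension count and conclusion *)

Lemma card_free_constraints (I K : finType) (S : K -> {set I}) (ref : K -> I) :
  (forall k, ref k \in S k) ->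
  (#|free_constraints S ref| + #|K| = \sum_k #|S k|)%N.
Proof.
move=> refP; rewrite -sum1_card -[#|K|]sum1_card.
rewrite (eq_bigl (fun ki => true && ((ki.2 \in S ki.1) && (ki.2 != ref ki.1))));
  last by move=> ki; rewrite inE.
rewrite -(pair_big_dep (fun=> true) (fun k i => (i \in S k) && (i != ref k))
  (fun _ _ => 1%N)) /= -big_split /=.
by apply: eq_bigr => k _; rewrite -sum1_card [in RHS](bigD1 (ref k)) //= addnC.
Qed.

Lemma card_K_of (I K : finType) (S : K -> {set I}) :
  (\sum_i #|K_of S i| = \sum_k #|S k|)%N.
Proof.
under eq_bigr => i _ do rewrite card_sig -sum1_card.
under [RHS]eq_bigr => k _ do rewrite -sum1_card.
by rewrite (exchange_big_dep predT).
Qed.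

Lemma pdimE (I : finType) (n : I -> nat) : pdim n = (\sum_i n i)%N.
Proof.
rewrite /pdim card_tagged sumnE big_map big_enum.
by apply: eq_bigr => i _; rewrite card_ord.
Qed.

Theorem theorem3p1 (R : realType) (I K : finType) (n p : I -> nat)
  (Mf : forall i : I, charted_space R (n i))
  (S : K -> {set I})
  (f : forall i : I, K -> Mf i -> R)
  (X : forall i : I, 'I_(p i) -> vfield (Mf i))
  (d := (#|K| + \sum_(i : I) p i)%N)
  (hM : forall i : I, is_manifold (Mf i))
  (hS : forall k : K, S k != finset.set0)
  (hsys : forall i : I,
     integrable_system (p i) #|K_of S i| (X i) (integrals_of S f i))
  (hind : forall x : prod_space Mf,
     diagonal_subset S f x -> independent_up_to_obvious S f x)
  (hreg : integrals_independent_along_diagonal S f d) :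
  is_manifold (diagonal_manifold S f d) /\
  exists Xh : {i : I & 'I_(p i)} -> vfield (diagonal_manifold S f d),
    (forall t : {i : I & 'I_(p i)},
       vfield_related
         (set_val : diagonal_manifold S f d -> prod_space Mf)
         (Xh t) (horizontal_lift (X (tag t) (tagged t)))) /\
    integrable_system (\sum_(i : I) p i)%N #|K| Xh
      (diagonal_integral S f d).
Proof.
have [ref refP] : exists ref : K -> I, forall k, ref k \in S k.
  apply: (choice_dep (P := fun k i => i \in S k)) => k.
  exact/finset.set0Pn.
(* Counting the pairs i in S_k in two ways: the sum of the |S_k| - 1, plus |K|, is the sum of the
   |K_i|, and p_i + |K_i| = n_i. *)
have hdim : (#|free_constraints S ref| + d = pdim n)%N.
  rewrite /d addnA card_free_constraints // -card_K_of pdimE -big_split.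
  by apply: eq_bigr => i _; rewrite /= addnC (integrable_dim (hsys i)).
have hf := factor_integrals_smooth hsys.
split; first exact: diagonal_is_manifold hM refP hf hind hdim.
exists (lifted_field (f := f) X (d := d)); split.
  by move=> t; exact: lifted_field_related hM refP hsys hind hdim t.
split.
(* The index type of the lifts is the one counted by [pdim], with p in place of n. *)
- by rewrite -pdimE.
- by [].
- by rewrite addnC.
- exact: lifted_field_smooth hM refP hsys hind hdim.
- exact: diagonal_integral_smooth hM refP hsys.
- by move=> s t c x; exact: lifted_field_commute hM refP hsys hind hdim s t c x.
- by move=> t k c x; exact: lifted_field_integral hM refP hsys hind hdim t k c x.
- exact: lifted_fields_ae hM refP hsys hind hdim hreg.
- exact: diagonal_integrals_ae hM refP hsys hind hdim hreg.
Qed.
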